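(* Let $G$ be a compact group, let $K$ be a homogeneous $G$-space, let $x_0\in K$, and let $S=\bigoplus_{\pi\in\Lambda}\mathcal E_\pi(K)\subset C(K)$, where $\Lambda\subset\widehat G$ is finite. Then $S$ is $G$-accessible. Moreover, the reproducing kernel of $S$ satisfies $$\mathbf k_S(x_0,x)=\sum_{\pi\in\Lambda}d_\pi\,\chi_\pi^K(x),\qquad x\in K.$$ Consequently, $$\boldsymbol\lambda(S)=\int_K\Big|\sum_{\pi\in\Lambda}d_\pi\,\chi_\pi^K(x)\Big|\,d\mu_K(x).$$
   Context: All function spaces and representations are complex; inner products are linear in the first variable. A homogeneous $G$-space is a compact Hausdorff space $K$ with a continuous transitive left action $(g,x)\mapsto g\bullet x$ of the compact group $G$; $\mu_K$ is the unique $G$-invariant regular Borel probability measure on $K$. Put $(L_gf)(x)=f(g^{-1}\bullet x)$; $S\subset C(K)$ is $G$-invariant if $L_g(S)\subset S$ for all $g$. A (bounded linear) projection $Q\colon C(K)\to S$ is $G$-equivariant if $QL_g=L_gQ$ for all $g\in G$. A finite-dimensional $G$-invariant subspace $S\subset C(K)$ is $G$-accessible if every $G$-equivariant projection $Q\colon C(K)\to S$ coincides with the restriction to $C(K)$ of the orthogonal projection $L_2(K,\mu_K)\to S$. The reproducing kernel of $S$ is $\mathbf k_S(x,y)=\sum_j\overline{f_j(x)}f_j(y)$ for any orthonormal basis $(f_j)$ of $S$ in $L_2(K,\mu_K)$. $\widehat G$ is the set of equivalence classes of irreducible unitary representations $\pi\colon G\to\mathcal U(V_\pi)$ (one representative per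 class), $d_\pi=\dim V_\pi$. With $H_{x_0}=\{h\in G:h\bullet x_0=x_0\}$, put $V_\pi^{H_{x_0}}=\{u\in V_\pi:\pi(h)u=u\ \forall h\in H_{x_0}\}$, $m_\pi(K)=\dim V_\pi^{H_{x_0}}$ and $\mathcal E_\pi(K)=\operatorname{span}\{g\bullet x_0\mapsto\langle v,\pi(g)u\rangle: u\in V_\pi^{H_{x_0}},\ v\in V_\pi\}\subset C(K)$ (independent of $x_0$). For any orthonormal basis $u^\pi_1,\dots,u^\pi_{m_\pi(K)}$ of $V_\pi^{H_{x_0}}$, define $\chi_\pi^K=\chi_{\pi,x_0}^K$ by $$\chi_{\pi}^K(g\bullet x_0)=\sum_{\ell=1}^{m_\pi(K)}\langle u_\ell^\pi,\pi(g)u_\ell^\pi\rangle,\qquad g\in G,$$ which is a well-defined function on $K$, independent of the orthonormal basis. Projection constants: $\boldsymbol\lambda(X,Y)=\inf\{\|P\|: P\in\mathcal L(Y),\ P^2=P,\ P(Y)=X\}$, $\boldsymbol\lambda(X)=\sup_Y\boldsymbol\lambda(X,Y)$ over all Banach spaces $Y$ containing $X$ isometrically; $S$ carries the supremum norm. *)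

(* Defs.v *)
From HB Require Import structures.
From mathcomp Require Import all_boot all_order all_algebra.
From mathcomp Require Import all_classical all_reals all_analysis.
From mathcomp Require Import complex.

Set Implicit Arguments.
Unset Strict Implicit.
Unset Printing Implicit Defensive.

Import Order.TTheory GRing.Theory Num.Theory Num.Def.
Import numFieldNormedType.Exports.

Local Open Scope classical_set_scope.
Local Open Scope ring_scope.
Local Open Scope complex_scope.

(* The topology of [R[i]] is the norm topology; this makes visible on [R[i]]  *)
(* the instances that MathComp-Analysis puts on [R[i]^o].                     *)
#[non_forgetful_inheritance]
HB.instance Definition _ (R : realType) :=
  PseudoPointedMetric.copy R[i] R[i]^o.
#[non_forgetful_inheritance]
HB.instance Definition _ (R : realType) := NormedModule.copy R[i] R[i]^o.

HB.mixin Record isTopologicalGroup G & Group G & Topological G := {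
  mulg_continuous : continuous (fun p : G * G => (p.1 * p.2)%g) ;
  invg_continuous : continuous (fun g : G => g^-1%g) }.

#[short(type="topologicalGroupType")]
HB.structure Definition TopologicalGroup :=
  {G of isTopologicalGroup G & Group G & Topological G}.

Definition compact_group (G : topologicalGroupType) : Prop :=
  compact [set: G] /\ hausdorff_space G.

Record homogeneous_space (G : topologicalGroupType) (K : topologicalType)
    (act : G -> K -> K) : Prop := HomogeneousSpace {
  space_compact : compact [set: K] ;
  space_hausdorff : hausdorff_space K ;
  act1 : forall x, act 1%g x = x ;
  actM : forall g h x, act (g * h)%g x = act g (act h x) ;
  act_continuous : continuous (fun p : G * K => act p.1 p.2) ;
  act_transitive : forall x y, exists g, act g x = y }.

Definition stabilizer (G : topologicalGroupType) (K : topologicalType)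
    (act : G -> K -> K) (x0 : K) : set G := [set h | act h x0 = x0].

(* A group element carrying [x0] to [x]. Functions on [K] prescribed by a     *)
(* formula at [act g x0] are defined through it; see [matrix_coefE] and       *)
(* [spherical_characterE] for the independence of the choice.                 *)
Definition transporter (G : topologicalGroupType) (K : topologicalType)
    (act : G -> K -> K) (x0 x : K) : G := xget 1%g [set g | act g x0 = x].

Lemma transporterP (G : topologicalGroupType) (K : topologicalType)
    (act : G -> K -> K) (x0 x : K) :
  homogeneous_space act -> act (transporter act x0 x) x0 = x.
Proof.
by move=> hK; rewrite /transporter; case: xgetP => [g -> //|] /=;
   have [g gx] := act_transitive hK x0 x => /(_ g).
Qed.

Definition borel (K : ptopologicalType) := g_sigma_algebraType (@open K).

Definition regular_measure (R : realType) (K : ptopologicalType)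
    (mu : set (borel K) -> \bar R) : Prop :=
  forall A : set (borel K), measurable A ->
    mu A = ereal_inf [set mu U | U in [set U : set K | open U /\ A `<=` U]] /\
    mu A = ereal_sup [set mu F | F in [set F : set K | compact F /\ F `<=` A]].

Definition invariant_measure (R : realType) (G : topologicalGroupType)
    (K : ptopologicalType) (act : G -> K -> K)
    (mu : set (borel K) -> \bar R) : Prop :=
  forall (g : G) (A : set (borel K)), measurable A -> mu (act g @` A) = mu A.

Section FunctionSpaces.
Context {R : realType} {G : topologicalGroupType} {K : ptopologicalType}.
Variables (act : G -> K -> K) (mu : {measure set (borel K) -> \bar R}).
Implicit Types (f h : K -> R[i]) (S : set (K -> R[i])).

Definition cintegral f : R[i] :=
  (\int[mu]_x complex.Re (f x)) +i* (\int[mu]_x complex.Im (f x)).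

Definition dotL2 f h : R[i] := cintegral (fun x => f x * (h x)^*).

Definition supnorm f : R := sup [set Normc.normc (f x) | x in [set: K]].

Definition CK : set (K -> R[i]) := [set f | continuous f].

Definition translate (g : G) f : K -> R[i] := fun x => f (act g^-1%g x).

Definition invariant_space S : Prop := forall g f, S f -> S (translate g f).

Definition finite_dim_subspace (V : lmodType R[i]) (S : set V) : Prop :=
  exists (n : nat) (e : 'I_n -> V),
    S = [set f | exists c : 'I_n -> R[i], f = \sum_i c i *: e i].

(* Bounded linear projections of [C(K)] onto [S]. A map on [C(K)] is          *)
(* represented by a map on all functions, of which only the values on [C(K)]  *)
(* matter.                                                                    *)
Record projection_onto S (Q : (K -> R[i]) -> (K -> R[i])) : Prop := {
  proj_range : forall f, CK f -> S (Q f) ;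
  proj_linear : forall (a : R[i]) f h, CK f -> CK h ->
    Q (a *: f + h) = a *: Q f + Q h ;
  proj_bounded : exists M : R, forall f, CK f ->
    supnorm (Q f) <= M * supnorm f ;
  proj_id : forall f, S f -> Q f = f }.

Definition equivariant (Q : (K -> R[i]) -> (K -> R[i])) : Prop :=
  forall g f, CK f -> Q (translate g f) = translate g (Q f).

(* [p] is the image of [f] under the orthogonal projection of [L_2] to [S].   *)
Definition orthogonal_projection S f (p : K -> R[i]) : Prop :=
  S p /\ forall s, S s -> dotL2 (f - p) s = 0.

Record accessible S : Prop := {
  accessible_sub : S `<=` CK ;
  accessible_dim : finite_dim_subspace S ;
  accessible_inv : invariant_space S ;
  accessible_proj : forall Q, projection_onto S Q -> equivariant Q ->
    forall f, CK f -> orthogonal_projection S f (Q f) }.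

Definition orthonormal_basisL2 S (n : nat) (e : 'I_n -> (K -> R[i])) : Prop :=
  (forall i j, dotL2 (e i) (e j) = (i == j)%:R) /\
  S = [set f | exists c : 'I_n -> R[i], f = \sum_i c i *: e i].

(* The reproducing kernel computed from the orthonormal basis [e]. *)
Definition reproducing_kernel (n : nat) (e : 'I_n -> (K -> R[i])) (x y : K) :
  R[i] := \sum_j (e j x)^* * e j y.

End FunctionSpaces.

(* Irreducible unitary representations of a compact group are                 *)
(* finite-dimensional. [rep_dot] is linear in its first argument.             *)
Record unitary_rep (R : realType) (G : topologicalGroupType) := UnitaryRep {
  rep_space : vectType R[i] ;
  rep_dot : {dot rep_space for conjC} ;
  rep_op : G -> 'End(rep_space) ;
  rep_op1 : rep_op 1%g = \1%VF ;
  rep_opM : forall g h, rep_op (g * h)%g = (rep_op g \o rep_op h)%VF ;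
  rep_unitary : forall g u v,
    rep_dot (rep_op g u) (rep_op g v) = rep_dot u v ;
  (* strong continuity: the squared norm of the increment tends to 0 *)
  rep_continuous : forall u g0,
    (fun g : G => rep_dot (rep_op g u - rep_op g0 u) (rep_op g u - rep_op g0 u))
      @ g0 --> (0 : R[i]) }.

Section Representations.
Context {R : realType} {G : topologicalGroupType}.

Definition rep_dim (pi : unitary_rep R G) : nat := \dim {:rep_space pi}.

Definition irreducible (pi : unitary_rep R G) : Prop :=
  (0 < rep_dim pi)%N /\
  forall W : {vspace rep_space pi},
    (forall g, (rep_op pi g @: W <= W)%VS) -> W = 0%VS \/ W = fullv.

Definition unitarily_equivalent (pi sigma : unitary_rep R G) : Prop :=
  exists T : 'Hom(rep_space pi, rep_space sigma),
    [/\ limg T = fullv,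
        forall u v, rep_dot sigma (T u) (T v) = rep_dot pi u v &
        forall g u, T (rep_op pi g u) = rep_op sigma g (T u)].

Context {K : ptopologicalType}.
Variables (act : G -> K -> K) (x0 : K).

Definition fixed_vectors (pi : unitary_rep R G) : set (rep_space pi) :=
  [set u | forall h, stabilizer act x0 h -> rep_op pi h u = u].
Arguments fixed_vectors : clear implicits.

Definition fixed_basis (pi : unitary_rep R G) (s : seq (rep_space pi)) : Prop :=
  orthonormal (rep_dot pi) s /\ fixed_vectors pi = [set` << s >>%VS].

(* The function [act g x0 |-> <v, pi(g) u>], for [u] in [fixed_vectors pi]. *)
Definition matrix_coef (pi : unitary_rep R G) (u v : rep_space pi) (x : K) :
  R[i] := rep_dot pi v (rep_op pi (transporter act x0 x) u).

Definition linear_span (V : lmodType R[i]) (A : set V) : set V :=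
  [set f | exists (n : nat) (c : 'I_n -> R[i]) (a : 'I_n -> V),
    (forall i, A (a i)) /\ f = \sum_i c i *: a i].

Definition Epi (pi : unitary_rep R G) : set (K -> R[i]) :=
  linear_span [set f | exists u v, fixed_vectors pi u /\ f = matrix_coef u v].

(* The sum of the spaces [E i]. For the spaces [Epi] of pairwise inequivalent *)
(* irreducible representations it is automatically direct.                    *)
Definition sum_spaces (V : lmodType R[i]) (I : finType) (E : I -> set V) :
  set V := [set f | exists F : I -> V,
    (forall i, E i (F i)) /\ f = \sum_i F i].

(* [chi_pi^K] at [act g x0] is the sum of the [<u, pi(g) u>], [u] running     *)
(* over the orthonormal basis [s] of [fixed_vectors pi].                      *)
Definition spherical_character (pi : unitary_rep R G) (s : seq (rep_space pi))
  (x : K) : R[i] :=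
  \sum_(u <- s) rep_dot pi u (rep_op pi (transporter act x0 x) u).

Lemma matrix_coefE (pi : unitary_rep R G) (u v : rep_space pi) (g : G) :
  homogeneous_space act -> fixed_vectors pi u ->
  matrix_coef u v (act g x0) = rep_dot pi v (rep_op pi g u).
Proof.
move=> hK fu; rewrite /matrix_coef; set t := transporter _ _ _.
have tE : act t x0 = act g x0 by exact: transporterP.
suff h : rep_op pi (g^-1 * t)%g u = u.
  by rewrite -{2}h -comp_lfunE -rep_opM mulgA mulgV mul1g.
by apply: fu; rewrite /stabilizer/= (actM hK) tE -(actM hK) mulVg (act1 hK).
Qed.

Lemma spherical_characterE (pi : unitary_rep R G) (s : seq (rep_space pi))
    (g : G) : homogeneous_space act -> fixed_basis s ->
  spherical_character s (act g x0) =
  \sum_(u <- s) rep_dot pi u (rep_op pi g u).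
Proof.
move=> hK [_ sE]; apply: eq_big_seq => u us; apply: matrix_coefE => //.
by rewrite sE/=; apply: memv_span.
Qed.

End Representations.

Section ProjectionConstants.
Context {R : realType}.

Definition opnorm (Y : normedModType R[i]) (P : Y -> Y) : \bar R :=
  ereal_sup [set (complex.Re `|P y|)%:E | y in [set y : Y | `|y| <= 1]].

Definition relative_projection_constant (Y : normedModType R[i]) (X : set Y) :
  \bar R :=
  ereal_inf [set opnorm P | P in [set P : {linear Y -> Y} |
    [/\ continuous P, forall y, P (P y) = P y & range P = X]]].

(* [X] is a linear subspace of [V], normed by [N]; a Banach space containing  *)
(* [X] isometrically is a Banach space [Y] with a linear isometry [j] from    *)
(* [X] to [Y] (only the values of [j] on [X] matter).                         *)
Definition projection_constant (V : lmodType R[i]) (N : V -> R) (X : set V) :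
  \bar R :=
  ereal_sup [set r | exists (Y : completeNormedModType R[i]) (j : V -> Y),
    [/\ forall (a : R[i]) f h, X f -> X h -> j (a *: f + h) = a *: j f + j h,
        forall f, X f -> `|j f| = (N f)%:C &
        r = relative_projection_constant (j @` X)]].

End ProjectionConstants.

(* Main.v *)
(* The space [S] has a finite orthonormal basis made of matrix coefficients   *)
(* (Schur orthogonality, integrated over [K]), with kernel                    *)
(* [k y x = \sum_j (e_j y)^* e_j x], which is invariant under [G] and equals  *)
(* [kappa] at [y = x0]. Since [S] contains the full isotypic components of    *)
(* [C(K)], it is stable under every equivariant map from [S] to functions, in *)
(* particular under integral operators with a continuous invariant kernel.    *)
(* So, for a bounded [Q : C(K) -> S] vanishing on [S] and a continuous        *)
(* invariant kernel [Phi],                                                    *)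
(*   [\int (Q (Phi (., x))) x dx = 0].                                        *)
(* This trace identity over [K] replaces averaging over the Haar measure of   *)
(* [G]. It yields accessibility (apply it to the difference of an equivariant *)
(* projection and the orthogonal one), and, with [Phi] a regularized sign of  *)
(* the conjugate of [k], the bound [\int |k x0 x| dx <= |P|] for every        *)
(* projection [P] onto [S]. Conversely, if [S] embeds isometrically in [Y],   *)
(* the Hahn-Banach theorem extends the integral formula                       *)
(* [f |-> \int f y * k y x dy] for the orthogonal projection to all of [Y],   *)
(* with norm at most [\int |k x0 x| dx].                                      *)

Require Import Defs.
From HB Require Import structures.
From mathcomp Require Import all_boot all_order all_algebra.
From mathcomp Require Import all_classical all_reals all_analysis.
From mathcomp Require Import measurable_realfun complex ring lra.

Set Implicit Arguments.
Unset Strict Implicit.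
Unset Printing Implicit Defensive.

Import Order.TTheory GRing.Theory Num.Theory.
Import numFieldNormedType.Exports Normc.

Local Open Scope classical_set_scope.
Local Open Scope complex_scope.
(* last, so that [z^*] always is [Num.conj], as in the products of Defs *)
Local Open Scope ring_scope.

(** * Complex norm and continuity *)

(** Schur's lemma, applied to the invariant forms that send [v] and [v'] to the L2 product of
    [coef u v] and [coef u' v'], gives the orthogonality relations over [K] ([coef_orthogonal],
    [coef_orthogonality]). Hence the functions sqrt(d_pi) <b_k, pi(.) u_l> are an orthonormal basis
    of [S], and Parseval in V_pi turns its kernel at [x0] into the sum of the d_pi chi_pi
    ([S_basis]). Every other orthonormal basis has the same kernel ([onb_kernel_unique]). From then
    on representation theory enters only through [equivariant_stable]: an equivariant linear map
    defined on [S] takes its values in [S].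

    The main tool is [trace_eq0]. Let Q : C(K) -> S be bounded and zero on [S], and let T be the
    integral operator of a continuous invariant kernel Phi. Then T maps [S] to itself, so Q T is
    zero on [S] and has trace 0; by [functional_Fubini] this trace is the integral of Q(Phi(.,
    x))(x) over x. Accessibility follows because the difference of an equivariant projection and
    [oproj] vanishes ([equivariant_eq0]). In the lower bound ([projection_lower_bound]) Phi is
    nearly the conjugate sign of the kernel k: then the trace of P is at most its norm, while that
    of [oproj] is nearly the integral of |k(x0, .)|. This is applied to projections of the Banach
    space [linf] of bounded functions onto [S].

    For the upper bound let [S] embed in Y. Each evaluation s |-> s(y) extends to a functional phi_y
    of norm at most one on Y, and P w (x) = int phi_y(w) k(y, x) dy should be a projection of norm
    at most the integral of |k(x0, .)|. To avoid a measurable choice of y |-> phi_y, the integral is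
    replaced by a linear functional that [Hahn_Banach] finds below the sublinear functional [upper]
    on J-tuples of vectors of Y ([upper_projection]). *)

Section ComplexNorm.
Context {R : realType}.
Notation C := R[i].

Lemma normcE (z : C) : `|z| = (normc z)%:C. Proof. by []. Qed.

Lemma normc_ge0 (z : C) : 0 <= normc z.
Proof. by case: z => a b; exact: sqrtr_ge0. Qed.

Lemma normc_eq0 (z : C) : (normc z == 0) = (z == 0).
Proof. by rewrite -[RHS]normr_eq0 normcE -[0 in RHS]/(0%:C) (inj_eq (@complexI
  R)). Qed.

Lemma Re_le_normc (z : C) : complex.Re z <= normc z.
Proof. by have := normc_ge_Re z; rewrite lecR => /(le_trans (ler_norm _)). Qed.

Lemma normcB (z w : C) : normc (z - w) = normc (w - z).
Proof. by rewrite -normcN opprB. Qed.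

Lemma normcJ (z : C) : normc z^* = normc z.
Proof. by have := complex.normcJ z => -[]. Qed.

Lemma normc_real (a : R) : normc a%:C = `|a|.
Proof. by rewrite /= expr0n /= addr0 sqrtr_sqr. Qed.

Lemma normcD3 (a b c : C) : normc (a - c) <= normc (a - b) + normc (b - c).
Proof. by apply: le_trans (le_normcD _ _); rewrite addrA subrK. Qed.

Lemma ImE (z : C) : complex.Im z = complex.Re (z * (- 'i%C)).
Proof. by case: z => a b /=; rewrite oppr0 mulr0 mulrN1 opprK add0r. Qed.

Lemma ler_dist_normc (z w : C) : `|normc z - normc w| <= normc (z - w).
Proof.
have sub (a b : C) : normc a - normc b <= normc (a - b).
  by rewrite lerBlDr -{1}[a](subrK b); exact: le_normcD.
by rewrite ler_norml sub andbT lerNl opprB normcB.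
Qed.

Lemma conjc_realE (a : R) : (a%:C)^* = a%:C.
Proof. exact: conjc_real. Qed.

Lemma mulJc_normc (z : C) : z * z^* = (normc z ^+ 2)%:C.
Proof. by rewrite -sqr_normc normcE rmorphXn. Qed.

Lemma ReD (z w : C) : complex.Re (z + w) = complex.Re z + complex.Re w.
Proof. by case: z; case: w. Qed.

Lemma ImD (z w : C) : complex.Im (z + w) = complex.Im z + complex.Im w.
Proof. by case: z; case: w. Qed.

(** Rotating by a unimodular factor turns a modulus into a value of a linear expression, so bounds
    on real parts become bounds on moduli. *)
Lemma phase (z : C) : exists2 a : C, normc a = 1 & a * z = (normc z)%:C.
Proof.
have [->|z0] := eqVneq z 0.
  by exists 1; [exact: normc1|rewrite mulr0 normc0].
have nz0 : normc z != 0 by rewrite normc_eq0.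
exists ((normc z)%:C^-1 * z^*).
  by rewrite normcM normcV normc_real ger0_norm ?normc_ge0 // normcJ mulVf.
rewrite -mulrA [z^* * z]mulrC mulJc_normc expr2 rmorphM mulKf //.
by rewrite fmorph_eq0.
Qed.

Lemma conjcM (z w : R[i]) : (z * w)^* = z^* * w^*.
Proof. exact: rmorphM. Qed.

Lemma conjc_sum {I : Type} (r : seq I) (F : I -> R[i]) :
  (\sum_(i <- r) F i)^* = \sum_(i <- r) (F i)^*.
Proof. by rewrite rmorph_sum. Qed.

Lemma conjcKK (z : R[i]) : z^*^* = z.
Proof. exact: conjcK. Qed.

End ComplexNorm.

Section ComplexContinuity.
Context {R : realType} {T : topologicalType}.
Notation C := R[i].
Implicit Types (f g : T -> C) (x : T) (h : T -> R).

(* A structure rather than a definition: failing unifications of continuity *)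
(* goals would otherwise unfold the topology of [R[i]].                       *)
Record ccont f : Prop := Ccont {
  ccont_near : forall x (e : R), 0 < e ->
    \forall y \near x, normc (f x - f y) < e }.

(** Real functions are tested through their complex embedding, so that the closure lemmas for
    [ccont] serve both kinds. *)
Definition rcont h := ccont (fun x => (h x)%:C).

Lemma ccontP f : continuous f <-> ccont f.
Proof.
split=> [cf|[cf] x].
  split=> x e e0; move/cvgrPdist_lt : (cf x) => /(_ e%:C);
    rewrite ltcR => /(_ e0).
  by apply: filterS => y; rewrite ltcR.
(* A positive element of [R[i]] is real, so the radius reduces to its real part. *)
apply/cvgrPdist_lt => -[e i]; rewrite ltcE /= => /andP[/eqP -> e0].
by apply: filterS (cf x e e0) => y; rewrite -ltcR.
Qed.

Lemma rcontP h : continuous h <-> rcont h.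
Proof.
split=> [ch|[ch] x].
  split=> x e e0; move/cvgrPdist_lt : (ch x) => /(_ e e0).
  by apply: filterS => y; rewrite -rmorphB normc_real.
apply/cvgrPdist_lt => e e0; move: (ch x e e0).
by apply: filterS => y; rewrite -rmorphB normc_real.
Qed.

Lemma ccont_cst (c : C) : ccont (fun _ : T => c).
Proof. by apply/ccontP => x; exact: cvg_cst. Qed.

Lemma ccontD f g : ccont f -> ccont g -> ccont (fun x => f x + g x).
Proof.
move=> /ccontP cf /ccontP cg; apply/ccontP => x; exact: cvgD (cf x) (cg x).
Qed.

Lemma ccontM f g : ccont f -> ccont g -> ccont (fun x => f x * g x).
Proof.
move=> /ccontP cf /ccontP cg; apply/ccontP => x; exact: cvgM (cf x) (cg x).
Qed.

Lemma ccontZ (a : C) f : ccont f -> ccont (fun x => a * f x).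
Proof. exact: ccontM (ccont_cst a). Qed.

Lemma ccontN f : ccont f -> ccont (fun x => - f x).
Proof. by move=> /ccontP cf; apply/ccontP => x; exact: cvgN (cf x). Qed.

Lemma ccontB f g : ccont f -> ccont g -> ccont (fun x => f x - g x).
Proof. by move=> cf cg; exact: ccontD cf (ccontN cg). Qed.

Lemma ccont_sum I (r : seq I) (F : I -> T -> C) :
  (forall i, ccont (F i)) -> ccont (fun x => \sum_(i <- r) F i x).
Proof.
move=> cF; elim: r => [|i r IHr].
  under eq_fun do rewrite big_nil.
  exact: ccont_cst.
by under eq_fun do rewrite big_cons; exact: ccontD.
Qed.

Lemma ccontJ f : ccont f -> ccont (fun x => (f x)^*).
Proof.
move=> [cf]; split=> x e e0; apply: filterS (cf x e e0) => y.
by rewrite -rmorphB normcJ.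
Qed.

Lemma rcont_lip f h : ccont f ->
  (forall x y, `|h x - h y| <= normc (f x - f y)) -> rcont h.
Proof.
move=> [cf] lip; split=> x e e0; apply: filterS (cf x e e0) => y.
by apply: le_lt_trans; rewrite -rmorphB normc_real.
Qed.

Lemma rcont_Re f : ccont f -> rcont (fun x => complex.Re (f x)).
Proof.
move=> cf; apply: rcont_lip cf _ => x y.
have -> : complex.Re (f x) - complex.Re (f y) = complex.Re (f x - f y).
  by case: (f x); case: (f y).
by have := normc_ge_Re (f x - f y); rewrite lecR.
Qed.

Lemma rcont_Im f : ccont f -> rcont (fun x => complex.Im (f x)).
Proof.
move=> cf; under eq_fun do rewrite ImE.
by apply: rcont_Re; exact: ccontM cf (ccont_cst _).
Qed.

Lemma rcont_normc f : ccont f -> rcont (fun x => normc (f x)).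
Proof. by move=> cf; apply: rcont_lip cf _ => x y; exact: ler_dist_normc. Qed.

Lemma rcontN h : rcont h -> rcont (fun x => - h x).
Proof.
move=> /ccontN; rewrite /rcont.
by under eq_fun do rewrite -rmorphN.
Qed.

Lemma rcontZ (a : R) h : rcont h -> rcont (fun x => a * h x).
Proof.
move=> /(ccontZ a%:C); rewrite /rcont.
by under eq_fun do rewrite -rmorphM.
Qed.

Lemma rcontD h (k : T -> R) : rcont h -> rcont k -> rcont (fun x => h x + k x).
Proof.
move=> ch /(ccontD ch); rewrite /rcont.
by under eq_fun do rewrite -rmorphD.
Qed.

End ComplexContinuity.

(** * Integration of continuous functions *)

Section Integration.
Context {R : realType} {K : ptopologicalType}.
Notation C := R[i].
Variable mu : probability (borel K) R.
Hypothesis cK : compact [set: K].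
Implicit Types (f g : K -> C) (h : K -> R).

Lemma ccont_bounded f : ccont f -> exists M : R, forall x, normc (f x) <= M.
Proof.
move=> [cf].
have /compact_near_coveringP/(_ R +oo (fun M x => normc (f x) <= M)) := cK.
case=> [x _|M [_ HM]]; last first.
  by exists (M + 1) => x; apply: (HM (M + 1)) => //; rewrite ltrDl.
(* Where [f] moves by less than 1, every number above [normc (f x) + 1] is a bound. *)
exists ([set y | normc (f x - f y) < 1], [set M | normc (f x) + 1 <= M]).
  split; first exact: cf.
  exact: nbhs_pinfty_ge (num_real _).
move=> [y M] /= [xy xM]; apply: le_trans xM.
rewrite -{1}[f y](subrK (f x)) (le_trans (le_normcD _ _))// addrC lerD2l.
by rewrite normcB ltW.
Qed.

Lemma supnorm_le f M : (forall x, normc (f x) <= M) -> supnorm f <= M.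
Proof.
move=> fM; apply: ge_sup; first by exists (normc (f point)); exists point.
by move=> _ [x _ <-].
Qed.

Lemma le_supnorm f x : ccont f -> normc (f x) <= supnorm f.
Proof.
move=> /ccont_bounded[M fM]; apply: ub_le_sup; last by exists x.
by exists M => _ [y _ <-].
Qed.

Lemma supnorm_ge0 f : ccont f -> 0 <= supnorm f.
Proof. by move=> cf; apply: le_trans (le_supnorm point cf);
  exact: normc_ge0. Qed.

Lemma rcont_measurable h :
  rcont h -> measurable_fun [set: borel K] (h : borel K -> R).
Proof.
move=> /rcontP/continuousP ch.
apply: (measurability _ (RGenOpens.measurableE R)).
move=> _ [_ [a [b ->] <-]]; rewrite setTI.
by apply: sub_sigma_algebra; apply: ch; exact: interval_open.
Qed.

Lemma rcont_integrable h :
  rcont h -> mu.-integrable [set: borel K] (EFin \o h).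
Proof.
move=> ch; apply: measurable_bounded_integrable => //.
- by apply: fin_num_fun_lty; exact: fin_num_measure.
- exact: rcont_measurable.
have [M hM] := ccont_bounded ch; exists M; split; first exact: num_real.
move=> N MN x _ /=; apply: le_trans (ltW MN).
by have := hM x; rewrite normc_real.
Qed.

Definition rint h : R := (\int[mu]_x h x)%R.
Definition cint f : C := cintegral mu f.

Lemma rintD h k : rcont h -> rcont k ->
  rint (fun x => h x + k x) = rint h + rint k.
Proof. by move=> ch ck; apply: RintegralD => //; exact: rcont_integrable. Qed.

Lemma rintZ a h : rcont h -> rint (fun x => a * h x) = a * rint h.
Proof. by move=> ch; apply: RintegralZl => //; exact: rcont_integrable. Qed.

Lemma rint_cst a : rint (fun=> a) = a.
Proof.
by rewrite /rint Rintegral_cst//= probability_setT mulr1.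
Qed.

Lemma rint_le h k : rcont h -> rcont k -> (forall x, h x <= k x) ->
  rint h <= rint k.
Proof.
by move=> ch ck hk; apply: le_Rintegral => //; exact: rcont_integrable.
Qed.

Lemma rint_ge0 h : (forall x, 0 <= h x) -> 0 <= rint h.
Proof. by move=> h0; apply: Rintegral_ge0. Qed.

Lemma rintE h : rcont h -> ((rint h)%:E = \int[mu]_x (h x)%:E)%E.
Proof.
move=> ch; rewrite /rint /Rintegral fineK//.
by apply: integrable_fin_num => //; exact: rcont_integrable.
Qed.

Lemma cint_real h : cint (fun x => (h x)%:C) = (rint h)%:C.
Proof. by rewrite /cint /cintegral /= -/(rint (fun=> 0)) rint_cst. Qed.

Lemma cintE f : cint f =
  rint (fun x => complex.Re (f x)) +i* rint (fun x => complex.Im (f x)).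
Proof. by []. Qed.

Lemma cintD f g : ccont f -> ccont g ->
  cint (fun x => f x + g x) = cint f + cint g.
Proof.
move=> cf cg; rewrite !cintE.
have ReP := rcont_Re; have ImP := rcont_Im.
under [X in rint X +i* _]eq_fun do rewrite ReD.
under [X in _ +i* rint X]eq_fun do rewrite ImD.
by rewrite !rintD //; [exact: ImP|exact: ImP|exact: ReP|exact: ReP].
Qed.

Lemma cintZ a f : ccont f -> cint (fun x => a * f x) = a * cint f.
Proof.
move=> cf; have cR := rcont_Re cf; have cI := rcont_Im cf.
rewrite !cintE; case: a => a b.
have -> : (fun x => complex.Re ((a +i* b) * f x)) =
    fun x => a * complex.Re (f x) + (- b) * complex.Im (f x).
  by apply/funext => x; case: (f x) => u v /=; rewrite mulNr.
have -> : (fun x => complex.Im ((a +i* b) * f x)) =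
    fun x => a * complex.Im (f x) + b * complex.Re (f x).
  by apply/funext => x; case: (f x) => u v.
rewrite !rintD ?rintZ; do ?[exact: cR|exact: cI|exact: rcontZ].
by rewrite mulNr.
Qed.

Lemma cint_cst c : cint (fun=> c) = c.
Proof. by rewrite cintE !rint_cst; case: c. Qed.

Lemma cintN f : ccont f -> cint (fun x => - f x) = - cint f.
Proof.
move=> cf; rewrite -mulN1r -cintZ //.
by congr cint; apply/funext => x; rewrite mulN1r.
Qed.

Lemma cintB f g : ccont f -> ccont g ->
  cint (fun x => f x - g x) = cint f - cint g.
Proof. by move=> cf cg; rewrite cintD ?cintN //; exact: ccontN. Qed.

Lemma cint_sum I (r : seq I) (F : I -> K -> C) : (forall i, ccont (F i)) ->
  cint (fun x => \sum_(i <- r) F i x) = \sum_(i <- r) cint (F i).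
Proof.
move=> cF; elim: r => [|i r IHr].
  by under eq_fun do rewrite big_nil; rewrite big_nil cint_cst.
under eq_fun do rewrite big_cons.
by rewrite cintD ?IHr ?big_cons //; exact: ccont_sum.
Qed.

Lemma cintJ f : ccont f -> cint (fun x => (f x)^*) = (cint f)^*.
Proof.
move=> cf; rewrite !cintE.
have -> : (fun x => complex.Re (f x)^*) = fun x => complex.Re (f x).
  by apply/funext => x; case: (f x).
have -> : (fun x => complex.Im (f x)^*) = fun x => -1 * complex.Im (f x).
  by apply/funext => x; case: (f x) => u v /=; rewrite mulN1r.
by rewrite rintZ ?mulN1r //; exact: rcont_Im.
Qed.

(** Multiply [f] by the phase that makes its integral real and nonnegative, then compare real parts
    with moduli. *)
Lemma normc_cint f : ccont f -> normc (cint f) <= rint (fun x => normc (f x)).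
Proof.
move=> cf; have [a a1 az] := phase (cint f).
have caf : ccont (fun x => a * f x) by exact: ccontZ.
have -> : normc (cint f) = rint (fun x => complex.Re (a * f x)).
  by move: az; rewrite -cintZ // cintE => -[].
apply: rint_le; [exact: rcont_Re|exact: rcont_normc|move=> x].
by rewrite (le_trans (Re_le_normc _))// normcM a1 mul1r.
Qed.

Lemma normc_cint_le f M : ccont f -> (forall x, normc (f x) <= M) ->
  normc (cint f) <= M.
Proof.
move=> cf fM; apply: le_trans (normc_cint cf) _; rewrite -[M]rint_cst.
by apply: rint_le => //; [exact: rcont_normc|exact: ccont_cst].
Qed.

End Integration.

(** * Continuous kernels and bounded functionals *)

Lemma maxr0_lip {R : realDomainType} (a b : R) :
  `|Num.max 0 a - Num.max 0 b| <= `|a - b|.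
Proof.
have := ler_norm (b - a); rewrite distrC; have := ler_norm (a - b).
rewrite /Num.max; move: `|a - b| => t; rewrite ler_norml.
by case: (ltP 0 a); case: (ltP 0 b) => *; apply/andP; split; lra.
Qed.

Lemma compact_seq_cover {T : ptopologicalType} {I : choiceType}
    (f : I -> set T) : compact [set: T] -> (forall i, open (f i)) ->
  (forall x, exists i, f i x) ->
  exists s : seq I, forall x, exists i, i \in s /\ f i x.
Proof.
rewrite compact_cover => cT fo fcov.
have [|D _ covD] := cT I [set: I] f (fun i _ => fo i).
  by move=> x _; have [i fxi] := fcov x; exists i.
by exists (finmap.enum_fset D) => x; have [i iD fxi] := covD x Logic.I;
  exists i.
Qed.

Section ProductContinuity.
Context {R : realType}.
Notation C := R[i].

Lemma rcont_near {T : topologicalType} (h : T -> R) :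
  (forall x (e : R), 0 < e -> \forall y \near x, `|h x - h y| < e) -> rcont h.
Proof.
move=> ch; split=> x e e0; apply: filterS (ch x e e0) => y.
by rewrite -rmorphB normc_real.
Qed.

Lemma rcontV {T : topologicalType} (h : T -> R) :
  rcont h -> (forall x, h x != 0) -> rcont (fun x => (h x)^-1).
Proof. by move=> /rcontP ch h0; apply/rcontP => x; exact: cvgV (ch x). Qed.

Lemma rcontM {T : topologicalType} (h k : T -> R) :
  rcont h -> rcont k -> rcont (fun x => h x * k x).
Proof.
move=> ch /(ccontM ch); rewrite /rcont.
by under eq_fun do rewrite -rmorphM.
Qed.

Lemma ccont_comp {S T : topologicalType} (f : T -> C) (u : S -> T) :
  continuous u -> ccont f -> ccont (fun s => f (u s)).
Proof.
move=> cu [cf]; split=> s e e0; exact: (cu s _ (cf (u s) e e0)).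
Qed.

(** The tube lemma: product neighbourhoods around the points of the compact factor are merged into
    one neighbourhood of [t] by [compact_near_coveringP]. *)
Lemma ccont_uniform {X T : topologicalType} (f : X * T -> C) :
  compact [set: X] -> ccont f -> forall t (e : R), 0 < e ->
  \forall t' \near t, forall x, normc (f (x, t) - f (x, t')) < e.
Proof.
move=> cX [cf] t e e0.
have /compact_near_coveringP/(_ T (nbhs t)
  (fun t' x => normc (f (x, t) - f (x, t')) < e)) := cX.
move=> H; apply: filterS (H _ _) => [t' Ht' x|x _]; first exact: Ht'.
have e20 : 0 < e / 2 by rewrite divr_gt0.
have [[A B] /= [Ax Bt] AB] := cf (x, t) (e / 2) e20.
exists (A, B) => //= -[x' t'] /= [Ax' Bt'].
apply: le_lt_trans (normcD3 _ (f (x, t)) _) _; rewrite [e]splitr ltrD//.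
  by rewrite normcB; apply: (AB (x', t)); split => //=; exact: nbhs_singleton.
by apply: (AB (x', t')).
Qed.

End ProductContinuity.

Section Kernels.
Context {R : realType} {K : ptopologicalType}.
Notation C := R[i].
Variable mu : probability (borel K) R.
Hypothesis cK : compact [set: K].
Implicit Types (f g : K -> C) (h : K -> R) (Phi : K -> K -> C).

Definition kcont Phi := ccont (fun p : K * K => Phi p.1 p.2).

Lemma kcont_l Phi x : kcont Phi -> ccont (fun y => Phi y x).
Proof.
move=> cPhi; apply: (ccont_comp (u := fun y => (y, x)) _ cPhi) => y.
by apply: cvg_pair => /=; [exact: cvg_id|exact: cvg_cst].
Qed.

Lemma kcont_r Phi y : kcont Phi -> ccont (Phi y).
Proof.
move=> cPhi; apply: (ccont_comp (u := fun x => (y, x)) _ cPhi) => x.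
by apply: cvg_pair => /=; [exact: cvg_cst|exact: cvg_id].
Qed.

Lemma kcont_fst f : ccont f -> kcont (fun y _ => f y).
Proof. by move=> cf; apply: (ccont_comp (u := fst) _ cf) => p;
  exact: cvg_fst. Qed.

Lemma kcont_snd f : ccont f -> kcont (fun _ x => f x).
Proof. by move=> cf; apply: (ccont_comp (u := snd) _ cf) => p;
  exact: cvg_snd. Qed.

Lemma cintZr a f : ccont f -> cint mu (fun x => f x * a) = cint mu f * a.
Proof.
by move=> cf; under eq_fun do rewrite mulrC; rewrite cintZ// mulrC.
Qed.

Lemma ccont_cint {T : topologicalType} (F : T -> K -> C) :
  ccont (fun p : T * K => F p.1 p.2) -> ccont (fun t => cint mu (F t)).
Proof.
move=> cF; have cFt t : ccont (F t).
  apply: (ccont_comp (u := fun x => (t, x)) _ cF) => x.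
  by apply: cvg_pair => /=; [exact: cvg_cst|exact: cvg_id].
have cF' : ccont (fun p : K * T => F p.2 p.1).
  apply: (ccont_comp (u := fun p => (p.2, p.1)) _ cF) => p.
  by apply: cvg_pair => /=; [exact: cvg_snd|exact: cvg_fst].
split=> t e e0; have e20 : 0 < e / 2 by rewrite divr_gt0.
have := ccont_uniform cK cF' t e20; apply: filterS => t' tt'.
rewrite -cintB //; apply: (@le_lt_trans _ _ (e / 2)); last first.
  by rewrite ltr_pdivrMr// mulr_natr mulr2n ltrDl.
apply: normc_cint_le => //; first exact: ccontB.
by move=> x; exact/ltW/tt'.
Qed.

Lemma kcont_cint Phi : kcont Phi -> ccont (fun y => cint mu (Phi y)).
Proof. exact: ccont_cint. Qed.

Section FiniteRank.
Variables (Phi : K -> K -> C) (cPhi : kcont Phi) (e : R) (e0 : 0 < e).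

Let d x x' := supnorm (fun y => Phi y x - Phi y x').

Let cd x x' : ccont (fun y => Phi y x - Phi y x').
Proof. by apply: ccontB; exact: kcont_l. Qed.

Let d_lip x x' x'' : `|d x x' - d x x''| <= d x' x''.
Proof.
have sub a b c : d a b - d a c <= d b c.
  rewrite lerBlDr; apply: supnorm_le => y.
  rewrite [leRHS]addrC; apply: le_trans (normcD3 _ (Phi y c) _) _; apply: lerD.
    exact: (le_supnorm cK y (cd a c)).
  by rewrite normcB; exact: (le_supnorm cK y (cd b c)).
rewrite ler_norml sub andbT lerNl opprB.
have -> : d x' x'' = d x'' x'; last exact: sub.
rewrite /d /supnorm; congr sup; apply/seteqP.
by split=> _ [y _ <-]; exists y => //; rewrite normcB.
Qed.

Lemma kcont_sup x : forall e', 0 < e' -> \forall x' \near x, d x x' < e'.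
Proof.
move=> e' e'0; have e20 : 0 < e' / 2 by rewrite divr_gt0.
have := ccont_uniform cK cPhi x e20; apply: filterS => x' xx'.
apply: (@le_lt_trans _ _ (e' / 2)).
  by apply: supnorm_le => y; exact/ltW/xx'.
by rewrite ltr_pdivrMr// mulr_natr mulr2n ltrDl.
Qed.

Let rho x x' := Num.max 0 (e - d x x').

Let rho_ge0 x x' : 0 <= rho x x'. Proof. by rewrite le_max lexx. Qed.

Let rho_cont x : rcont (rho x).
Proof.
apply: rcont_near => x' e' e'0; apply: filterS (kcont_sup x' e'0) => x''.
apply: le_lt_trans; apply: le_trans (d_lip x x' x'').
apply: le_trans (maxr0_lip _ _) _.
have -> : e - d x x' - (e - d x x'') = - (d x x' - d x x'') by ring.
by rewrite normrN.
Qed.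

(** A partition of unity in the second variable, subordinate to finitely many balls of the
    pseudometric [d]; it replaces [Phi] by a finite sum of products, for which exchanging a
    functional and an integral is mere linearity. *)
Lemma finite_rank_approx : exists (s : seq K) (w : K -> K -> R),
  (forall x, rcont (w x)) /\ forall y x',
  normc (Phi y x' - \sum_(x <- s) (w x x')%:C * Phi y x) <= e.
Proof.
have op x : open [set x' | 0 < rho x x'].
  have /rcontP/continuousP := rho_cont x.
  by move=> /(_ [set t | 0 < t]); apply; exact: open_gt.
have cov x : exists x', [set x'' | 0 < rho x' x''] x.
  exists x => /=; rewrite lt_max ltxx subr_gt0 /=.
  exact: nbhs_singleton (kcont_sup x e0).
have [D covD] := compact_seq_cover cK op cov.
pose S x' := \sum_(x <- D) rho x x'.
have S0 x' : 0 < S x'.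
  have [x [xD x0]] := covD x'.
  rewrite /S (big_rem x) //= ltr_pwDl//; exact: sumr_ge0.
have cS : rcont S.
  rewrite /rcont /S; under eq_fun do rewrite rmorph_sum /=.
  exact: ccont_sum.
exists D, (fun x x' => rho x x' * (S x')^-1); split=> [x|y x'].
  by apply: rcontM => //; apply: rcontV => // x'; rewrite gt_eqF.
have w1 : \sum_(x <- D) rho x x' * (S x')^-1 = 1.
  by rewrite -mulr_suml; exact: mulfV (lt0r_neq0 (S0 x')).
have -> : Phi y x' - \sum_(x <- D) (rho x x' * (S x')^-1)%:C * Phi y x =
    \sum_(x <- D) (rho x x' * (S x')^-1)%:C * (Phi y x' - Phi y x).
  rewrite (eq_bigr _ (fun x _ => mulrBr _ _ _)) sumrB -mulr_suml -rmorph_sum.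
  by rewrite w1 /= mul1r.
have -> : e = \sum_(x <- D) rho x x' * (S x')^-1 * e.
  by rewrite -mulr_suml w1 mul1r.
(* The estimate is now termwise: the weight of [x] vanishes unless [d x x' < e]. *)
move: (S x') (S0 x') => t t0 {w1 covD S0 cS S}.
elim: D => [|x s IHs]; first by rewrite !big_nil normc0.
rewrite !big_cons (le_trans (le_normcD _ _))// lerD// normcM normc_real.
have w0 : 0 <= rho x x' / t by rewrite divr_ge0// ltW.
rewrite ger0_norm// /rho /Num.max; case: ltP => [dx|dx]; last by rewrite !mul0r.
rewrite ler_wpM2l//; first by rewrite divr_ge0// ltW.
rewrite normcB (le_trans (le_supnorm cK y (cd x x')))// -/(d x x').
by rewrite ltW// -subr_gt0.
Qed.

End FiniteRank.

(** A continuous linear functional on C(K), that is, a complex measure used without its Riesz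
    representation. Only the values on continuous functions matter. *)
Record bounded_functional (nu : (K -> C) -> C) : Prop := BoundedFunctional {
  bf_linear : forall a f g, ccont f -> ccont g ->
    nu (fun x => a * f x + g x) = a * nu f + nu g ;
  bf_bounded : exists2 M : R, 0 <= M & forall f, ccont f ->
    normc (nu f) <= M * supnorm f }.

Section BoundedFunctionals.
Variables (nu : (K -> C) -> C) (bnu : bounded_functional nu).

Lemma bf0 : nu (fun=> 0) = 0.
Proof.
have := bf_linear bnu 1 (ccont_cst 0) (ccont_cst 0).
rewrite (_ : (fun=> _) = fun=> 0); last by apply/funext => x;
  rewrite mul1r addr0.
by rewrite mul1r -[X in X = _]addr0 => /addrI.
Qed.

Lemma bfZ a f : ccont f -> nu (fun x => a * f x) = a * nu f.
Proof.
move=> cf; have := bf_linear bnu a cf (ccont_cst 0); rewrite bf0 addr0 => <-.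
by congr nu; apply/funext => x; rewrite addr0.
Qed.

Lemma bfD f g : ccont f -> ccont g -> nu (fun x => f x + g x) = nu f + nu g.
Proof.
move=> cf cg; rewrite -[nu f]mul1r -(bf_linear bnu) //.
by congr nu; apply/funext => x; rewrite mul1r.
Qed.

Lemma bfB f g : ccont f -> ccont g -> nu (fun x => f x - g x) = nu f - nu g.
Proof.
move=> cf cg; rewrite addrC -mulN1r -(bf_linear bnu) //.
by congr nu; apply/funext => x; rewrite mulN1r addrC.
Qed.

Lemma bf_sum I (r : seq I) (F : I -> K -> C) : (forall i, ccont (F i)) ->
  nu (fun x => \sum_(i <- r) F i x) = \sum_(i <- r) nu (F i).
Proof.
move=> cF; elim: r => [|i r IHr].
  by under eq_fun do rewrite big_nil; rewrite big_nil bf0.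
under eq_fun do rewrite big_cons.
by rewrite bfD ?IHr ?big_cons //; exact: ccont_sum.
Qed.

Lemma bf_kernel_cont Phi : kcont Phi -> ccont (fun x => nu (fun y => Phi y x)).
Proof.
move=> cPhi; split=> x e e0; have [M M0 nuM] := bf_bounded bnu.
have eM : 0 < e / (M + 1) by rewrite divr_gt0// ltr_wpDl.
apply: filterS (kcont_sup cPhi x eM) => x' xx'.
have [cx cx'] := (kcont_l x cPhi, kcont_l x' cPhi).
rewrite -bfB // (le_lt_trans (nuM _ (ccontB cx cx')))//.
rewrite ltr_pdivlMr ?ltr_wpDl // in xx'.
apply: le_lt_trans xx'; rewrite mulrC ler_wpM2l ?lerDl//.
exact/supnorm_ge0/ccontB.
Qed.

(** For kernels of finite rank this is linearity, and both sides change little when the kernel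
    changes little in the uniform norm. *)
Lemma functional_Fubini Phi : kcont Phi ->
  nu (fun y => cint mu (Phi y)) = cint mu (fun x => nu (fun y => Phi y x)).
Proof.
move=> cPhi; apply/eqP; rewrite -subr_eq0 -normc_eq0 eq_le normc_ge0 andbT.
have [M M0 nuM] := bf_bounded bnu.
apply/ler_addgt0Pl => e' e'0; rewrite addr0.
(* Replacing the kernel costs at most [M * e] on each side, and [e'] equals [2 * M * e + 2 * e]; the
   summand 1 avoids a division by 0. *)
pose e := e' / (2 * (M + 1)).
have e0 : 0 < e by rewrite divr_gt0// mulr_gt0// ltr_wpDl.
have [s [w [cw Hw]]] := finite_rank_approx cPhi e0.
have cwF x : kcont (fun y x' => (w x x')%:C * Phi y x).
  apply: ccontM; first exact: kcont_snd (cw x).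
  exact: kcont_fst (kcont_l x cPhi).
have cPsi : kcont (fun y x' => \sum_(x <- s) (w x x')%:C * Phi y x).
  exact: ccont_sum.
pose m := \sum_(x <- s) (rint mu (w x))%:C * nu (fun y => Phi y x).
apply: le_trans (normcD3 _ m _) _.
have -> : e' = M * e + M * e + 2 * e.
  by rewrite /e; field; rewrite gt_eqF// ltr_wpDl.
have e2 : 0 <= 2 * e by rewrite mulr_ge0// ltW.
rewrite -addrA lerD//; last rewrite (le_trans _ (_ : M * e <= _))// ?lerDl//.
  have -> : m = nu (fun y => cint mu (fun x' => \sum_(x <- s) (w x x')%:C * Phi
    y x)).
    rewrite (_ : (fun y => cint mu _) =
      fun y => \sum_(x <- s) (rint mu (w x))%:C * Phi y x); last first.
    apply/funext => y; rewrite cint_sum => [|//|x]; last exact: kcont_r (cwF x).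
    by apply: eq_bigr => x _; rewrite (cintZr _ (cw x)) cint_real.
  rewrite bf_sum => [|x]; last exact: ccontZ (kcont_l x cPhi).
  by apply: eq_bigr => x _; rewrite bfZ //; exact: kcont_l.
  have c1 := kcont_cint cPhi; have c2 := kcont_cint cPsi.
  rewrite -bfB // (le_trans (nuM _ (ccontB c1 c2)))// ler_wpM2l//.
  apply: supnorm_le => y.
  have [cy1 cy2] := (kcont_r y cPhi, kcont_r y cPsi).
  rewrite -cintB //; apply: normc_cint_le => //; exact: ccontB.
have cb := bf_kernel_cont cPhi.
have cwb x : ccont (fun x' => (w x x')%:C * nu (fun y => Phi y x)).
  by apply: ccontM; [exact: cw|exact: ccont_cst].
have -> : m = cint mu (fun x' => \sum_(x <- s) (w x x')%:C * nu (fun y => Phi y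
  x)).
  rewrite cint_sum //; apply: eq_bigr => x _.
  by rewrite (cintZr _ (cw x)) cint_real.
rewrite -cintB //; last exact: ccont_sum.
apply: normc_cint_le => //; first by apply: ccontB => //; exact: ccont_sum.
move=> x'; rewrite normcB.
have -> : \sum_(x <- s) (w x x')%:C * nu (fun y => Phi y x) =
    nu (fun y => \sum_(x <- s) (w x x')%:C * Phi y x).
  rewrite bf_sum => [|x]; last exact: ccontZ (kcont_l x cPhi).
  by apply: eq_bigr => x _; rewrite bfZ //; exact: kcont_l.
have [cx1 cx2] := (kcont_l x' cPhi, kcont_l x' cPsi).
rewrite -bfB // (le_trans (nuM _ (ccontB cx1 cx2)))// ler_wpM2l//.
by apply: supnorm_le => y.
Qed.

End BoundedFunctionals.
End Kernels.

(** * Homogeneous spaces *)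

Section Homogeneous.
Context {R : realType} {G : topologicalGroupType} {K : ptopologicalType}.
Context {act : G -> K -> K}.
Notation C := R[i].
Variable mu : probability (borel K) R.
Hypothesis cG : compact [set: G].
Hypothesis hK : homogeneous_space act.
Hypothesis inv : invariant_measure act mu.
Implicit Types (f : K -> C) (h : K -> R) (Phi : K -> K -> C) (g : G).

Let cK : compact [set: K] := space_compact hK.

Lemma actK g : cancel (act g) (act g^-1%g).
Proof. by move=> x; rewrite -(actM hK) mulVg (act1 hK). Qed.

Lemma actVK g : cancel (act g^-1%g) (act g).
Proof. by move=> x; rewrite -(actM hK) mulgV (act1 hK). Qed.

Lemma continuous_act g : continuous (act g).
Proof.
move=> x; have H : continuous (fun p : G * K => act p.1 p.2).
  exact: act_continuous hK.
apply: (@cvg_comp _ _ _ (fun x => (g, x)) (fun p => act p.1 p.2) _ (nbhs (g,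
  x))).
  by apply: cvg_pair => /=; [exact: cvg_cst|exact: cvg_id].
exact: (H (g, x)).
Qed.

Lemma ccont_act g f : ccont f -> ccont (fun x => f (act g x)).
Proof. by move=> cf; exact: ccont_comp (@continuous_act g) cf. Qed.

Lemma measurable_act g : measurable_fun [set: borel K] (act g : borel K ->
  borel K).
Proof.
apply: (@measurability _ _ (borel K) (borel K) _ _ (@open K)) => //.
move=> _ [U oU <-]; rewrite setTI.
apply: sub_sigma_algebra.
by have /continuousP := @continuous_act g; apply.
Qed.

Lemma rint_act g h : rcont h -> rint mu (fun x => h (act g x)) = rint mu h.
Proof.
move=> ch; have ch' : rcont (fun x => h (act g x)).
  exact: (ccont_act g ch).
rewrite /rint /Rintegral; congr fine.
have := @integral_pushforward _ _ _ _ R _ (measurable_act g) mu setT (EFin \o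
  h).
rewrite preimage_setT => <- //; last 2 first.
- apply/measurable_EFinP; exact: rcont_measurable ch.
- exact: rcont_integrable ch'.
apply: eq_measure_integral => [|mg A mA _]; first exact: measurable_act.
(* Invariance is stated for images; a preimage under [act g] is the image under the inverse
   element. *)
apply: etrans (inv g^-1%g mA); rewrite /= /pushforward; congr (mu _).
by apply/seteqP; split=> [x Ax|_ [x Ax <-]] /=; [exists (act g x)|];
  rewrite ?actK ?actVK.
Qed.

Lemma cint_act g f : ccont f -> cint mu (fun x => f (act g x)) = cint mu f.
Proof.
move=> cf; rewrite !cintE.
by rewrite (rint_act g (rcont_Re cf)) (rint_act g (rcont_Im cf)).
Qed.

(** The measure has full support: by transitivity and compactness finitely many translates of the
    open set where [h] exceeds [h y / 2] cover [K], so a finite sum of translates of [h], all with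
    the same integral, is at least [h y / 2]. *)
Lemma rint_gt0 h y : rcont h -> (forall x, 0 <= h x) -> 0 < h y ->
  0 < rint mu h.
Proof.
move=> ch h0 hy; have e0 : 0 < h y / 2 by rewrite divr_gt0.
pose U g : set K := [set x | h y / 2 < h (act g x)].
have oU g : open (U g).
  have /rcontP/continuousP := ccont_act g ch.
  by move=> /(_ [set t | h y / 2 < t]); apply; exact: open_gt.
have cov x : exists g, U g x.
  have [g gx] := act_transitive hK x y; exists g; rewrite /U /= gx.
  by rewrite ltr_pdivrMr// mulr_natr mulr2n ltrDl.
have [s covs] := compact_seq_cover cK oU cov.
have cs (t : seq G) : rcont (fun x => \sum_(g <- t) h (act g x)).
  rewrite /rcont; under eq_fun do rewrite rmorph_sum /=.
  by apply: ccont_sum => g; exact: (ccont_act g ch).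
have : h y / 2 <= rint mu (fun x => \sum_(g <- s) h (act g x)).
  rewrite -[leLHS](rint_cst mu); apply: (rint_le mu cK) => //.
    exact: ccont_cst.
  move=> x; have [g [gs gx]] := covs x.
  rewrite (big_rem g) //= -[leLHS]addr0 lerD//; first exact: ltW gx.
  by apply: sumr_ge0.
have -> : rint mu (fun x => \sum_(g <- s) h (act g x)) = (size s)%:R * rint mu
  h.
  elim: (s) => [|g t IHt].
    by under eq_fun do rewrite big_nil; rewrite rint_cst mul0r.
  under eq_fun do rewrite big_cons.
  rewrite (rintD mu cK (ccont_act g ch) (cs t)) (rint_act g ch) IHt.
  by rewrite /= -natr1 mulrDl mul1r addrC.
move=> /(lt_le_trans e0); rewrite [_ < rint _ _]lt_neqAle rint_ge0// andbT.
by apply: contraTN => /eqP <-; rewrite mulr0 ltxx.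
Qed.

Lemma cint_normc_eq0 f : ccont f -> cint mu (fun x => f x * (f x)^*) = 0 ->
  forall x, f x = 0.
Proof.
move=> cf; under eq_fun do rewrite mulJc_normc.
rewrite cint_real => -[f0] x; apply/eqP; apply: contra_eqT f0 => fx0.
rewrite gt_eqF//; apply: (@rint_gt0 _ x).
- by under eq_fun do rewrite expr2; apply: rcontM; exact: rcont_normc.
- by move=> y; exact: sqr_ge0.
- by rewrite exprn_even_gt0//= normc_eq0.
Qed.

Definition kinv Phi := forall g y x, Phi (act g y) (act g x) = Phi y x.

Section InvariantMetric.
Variables (f : K -> C) (cf : ccont f).

Definition orbit_dist y x : R :=
  sup [set normc (f (act g y) - f (act g x)) | g in [set: G]].

Lemma orbit_dist_le y x M :
  (forall g, normc (f (act g y) - f (act g x)) <= M) -> orbit_dist y x <= M.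
Proof.
move=> fM; apply: ge_sup; last by move=> _ [g _ <-].
by exists (normc (f (act 1%g y) - f (act 1%g x))); exists 1%g.
Qed.

Lemma le_orbit_dist y x g :
  normc (f (act g y) - f (act g x)) <= orbit_dist y x.
Proof.
have [M fM] := ccont_bounded cK cf.
apply: ub_le_sup; last by exists g.
exists (M + M) => _ [g' _ <-]; rewrite (le_trans (le_normcD _ _))//.
by rewrite lerD// normcN.
Qed.

Lemma orbit_distC y x : orbit_dist y x = orbit_dist x y.
Proof.
by congr sup; apply/seteqP; split=> _ [g _ <-]; exists g => //; rewrite normcB.
Qed.

Lemma orbit_distxx x : orbit_dist x x = 0.
Proof.
apply/eqP; rewrite eq_le orbit_dist_le => [/=|g]; last by rewrite subrr normc0.
by apply: le_trans (le_orbit_dist x x 1%g); exact: normc_ge0.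
Qed.

Lemma orbit_dist_triangle y x z :
  orbit_dist y z <= orbit_dist y x + orbit_dist x z.
Proof.
apply: orbit_dist_le => g; apply: le_trans (normcD3 _ (f (act g x)) _) _.
by apply: lerD; exact: le_orbit_dist.
Qed.

Lemma orbit_dist_act g y x : orbit_dist (act g y) (act g x) = orbit_dist y x.
Proof.
congr sup; apply/seteqP; split=> _ [g' _ <-].
  by exists (g' * g)%g => //; rewrite !(actM hK).
by exists (g' * g^-1)%g => //; rewrite !(actM hK) !actK.
Qed.

(** Compactness of [G] makes the continuity of [f (act g x)] in [x] uniform in [g], so the supremum
    over the group still yields a continuous pseudometric. *)
Lemma orbit_dist_near x (e : R) : 0 < e -> \forall x' \near x, orbit_dist x x'
  < e.
Proof.
move=> e0; have e20 : 0 < e / 2 by rewrite divr_gt0.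
have cF : ccont (fun p : G * K => f (act p.1 p.2)).
  exact: ccont_comp (act_continuous hK) cf.
apply: filterS (ccont_uniform cG cF x e20) => x' xx'.
apply: (@le_lt_trans _ _ (e / 2)).
  by apply: orbit_dist_le => g; exact/ltW/xx'.
by rewrite ltr_pdivrMr// mulr_natr mulr2n ltrDl.
Qed.

Lemma orbit_dist_lip y x y' x' :
  `|orbit_dist y x - orbit_dist y' x'| <= orbit_dist y y' + orbit_dist x x'.
Proof.
have t := orbit_dist_triangle.
rewrite ler_norml; apply/andP; split.
  have := t y' y x'; have := t y x x'; rewrite (orbit_distC y' y); lra.
have := t y y' x; have := t y' x' x; rewrite (orbit_distC x' x); lra.
Qed.

Definition bump e y x : R := Num.max 0 (e - orbit_dist y x).

Lemma bump_cont e : kcont (fun y x => (bump e y x)%:C).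
Proof.
apply: (@rcont_near _ _ (fun p => bump e p.1 p.2)) => -[y x] /= e' e'0.
have e20 : 0 < e' / 2 by rewrite divr_gt0.
exists ([set y' | orbit_dist y y' < e' / 2], [set x' | orbit_dist x x' < e' /
  2]).
  by split; exact: orbit_dist_near.
move=> -[y' x'] /= [yy' xx'].
apply: le_lt_trans (maxr0_lip _ _) _.
have -> : e - orbit_dist y x - (e - orbit_dist y' x') =
  - (orbit_dist y x - orbit_dist y' x') by ring.
rewrite normrN (le_lt_trans (orbit_dist_lip _ _ _ _))// [e']splitr.
exact: ltrD.
Qed.

(* [Phi] is a normalized bump function of the invariant pseudometric         *)
(* [sup_g |f (g y) - f (g x)|], so that averaging [f] against it moves the    *)
(* values of [f] by at most [e]; no Haar measure on [G] is involved.          *)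
Lemma invariant_approx e : 0 < e -> exists Phi, [/\ kcont Phi, kinv Phi &
  forall y, normc (f y - cint mu (fun x => Phi y x * f x)) <= e].
Proof.
(* The normalizing constant: by transitivity and invariance the bumps around all centres have this
   integral, and it is positive since a bump equals [e] at its centre. *)
move=> e0; pose c := rint mu (bump e point).
have b0 y x : 0 <= bump e y x by rewrite le_max lexx.
have cb y : rcont (bump e y) by exact: kcont_r y (bump_cont e).
have ib g y x : bump e (act g y) (act g x) = bump e y x.
  by rewrite /bump orbit_dist_act.
have bc y : rint mu (bump e y) = c.
  have [g gy] := act_transitive hK point y.
  rewrite -(rint_act g (cb y)) -gy /c; congr rint; apply/funext => x.
  exact: ib.
have c0 : 0 < c.
  by apply: (@rint_gt0 _ point) => //;
    rewrite /bump orbit_distxx subr0 lt_max e0 orbT.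
exists (fun y x => (c^-1 * bump e y x)%:C); split.
- exact: (@rcontZ _ _ c^-1 (fun p => bump e p.1 p.2) (bump_cont e)).
- by move=> g y x; rewrite ib.
move=> y; set w := fun x => c^-1 * bump e y x.
have cw : rcont w by exact: rcontZ.
have w1 : rint mu w = 1 by rewrite /w (rintZ _ cK)// bc mulVf ?gt_eqF.
have -> : f y - cint mu (fun x => (w x)%:C * f x) =
    cint mu (fun x => (w x)%:C * (f y - f x)).
  under [in RHS]eq_fun do rewrite mulrBr.
  have cwy : ccont (fun x => (w x)%:C * f y) by exact: ccontM cw (ccont_cst _).
  rewrite (cintB mu cK cwy (ccontM cw cf)) (cintZr mu cK _ cw) cint_real w1.
  by rewrite mul1r.
have cd : ccont (fun x => (w x)%:C * (f y - f x)).
  exact: ccontM cw (ccontB (ccont_cst _) cf).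
apply: le_trans (normc_cint mu cK cd) _.
have -> : e = rint mu (fun x => e * w x) by rewrite (rintZ _ cK)// w1 mulr1.
apply: (rint_le mu cK (rcont_normc cd)); first exact: rcontZ.
move=> x; have w0 : 0 <= w x by rewrite mulr_ge0// invr_ge0 ltW.
rewrite normcM normc_real ger0_norm// mulrC.
have [d|d] := ltP (orbit_dist y x) e.
  rewrite ler_wpM2r// (le_trans _ (ltW d))//.
  by have := le_orbit_dist y x 1%g; rewrite !(act1 hK).
have -> : w x = 0; last by rewrite !mulr0.
by rewrite /w /bump; have /max_idPl -> : e - orbit_dist y x <= 0;
  rewrite ?subr_le0 ?mulr0.
Qed.

End InvariantMetric.

End Homogeneous.

Arguments kinv {R G K} act Phi.

(** * Unitary representations *)

Section OrthonormalBases.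
Context {R : realType} {V : vectType R[i]}.
Variable dot : {dot V for (@Num.conj R[i])}.
Notation C := R[i].
Notation "''[' u , v ]" := (dot u v).
Implicit Types (u v w : V) (s : seq V).

Lemma dotC u v : '[u, v] = '[v, u]^*.
Proof. by rewrite (hermC dot u v) mul1r. Qed.

Lemma dotDl u v w : '[u + v, w] = '[u, w] + '[v, w].
Proof. exact: linearDl. Qed.

Lemma dotZl (a : C) u v : '[a *: u, v] = a * '[u, v].
Proof. exact: linearZl_LR. Qed.

Lemma dotDr u v w : '[u, v + w] = '[u, v] + '[u, w].
Proof. exact: linearDr. Qed.

Lemma dotZr (a : C) u v : '[u, a *: v] = a^* * '[u, v].
Proof. exact: linearZr_LR. Qed.

Lemma dotBl u v w : '[u - v, w] = '[u, w] - '[v, w].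
Proof. exact: linearBl. Qed.

Lemma dotBr u v w : '[u, v - w] = '[u, v] - '[u, w].
Proof. exact: linearBr. Qed.

Lemma dot_suml I (r : seq I) (F : I -> V) w :
  '[\sum_(i <- r) F i, w] = \sum_(i <- r) '[F i, w].
Proof. exact: linear_sumlz. Qed.

Lemma dot_sumr I (r : seq I) (F : I -> V) w :
  '[w, \sum_(i <- r) F i] = \sum_(i <- r) '[w, F i].
Proof. exact: linear_sumr. Qed.

Lemma dotv_eq0 u : '[u, u] = 0 -> u = 0.
Proof. by move/eqP; rewrite dnorm_eq0 => /eqP. Qed.

Lemma dot_ext u v : (forall w, '[u, w] = '[v, w]) -> u = v.
Proof.
move=> uv; apply/eqP; rewrite -subr_eq0; apply/eqP/dotv_eq0.
by rewrite dotBl uv subrr.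
Qed.

Lemma dotvvE u : '[u, u] = (complex.Re '[u, u])%:C.
Proof.
have := dnorm_ge0 dot u; rewrite lecE => /andP[/eqP] /=.
by case: ('[u, u]) => r i /= ->.
Qed.

Lemma dotvv_gt0 u : u != 0 -> 0 < complex.Re '[u, u].
Proof. by rewrite -(dnorm_gt0 dot) dotvvE ltcR. Qed.

Lemma dot_normalize u : u != 0 -> exists2 c : C, c != 0 & '[c *: u, c *: u] = 1.
Proof.
move=> /dotvv_gt0 u0; set r := complex.Re _ in u0.
exists (Num.sqrt r)^-1%:C.
  by rewrite fmorph_eq0 invr_eq0 gt_eqF// sqrtr_gt0.
rewrite dotZl dotZr conjc_realE dotvvE -/r -!rmorphM /= mulrA -expr2 exprVn.
by rewrite sqr_sqrtr ?mulVf ?gt_eqF// ltW.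
Qed.

Lemma Gram_Schmidt s : exists2 b : seq V, orthonormal dot b & (<< b >> = << s
  >>)%VS.
Proof.
elim: s => [|x s [b ob bs]]; first by exists [::].
have [p pb [q [xpq _ qb]]] := orthogonal_split dot b x.
have xbE : (<< x :: s >> = <[q]> + << b >>)%VS.
  rewrite span_cons -bs xpq; apply/eqP; rewrite eqEsubv !subv_add.
  rewrite !addvSr !andbT -!memvE; apply/andP; split.
    by rewrite addrC memv_add ?memv_line.
  by rewrite -{1}[q](addKr p) addrC memv_add ?memv_line ?memvN.
have [q0|q0] := eqVneq q 0.
  by exists b => //; rewrite xbE q0; apply/esym/addv_idPr; rewrite -memvE mem0v.
have [c c0 cq] := dot_normalize q0.
exists (c *: q :: b); last first.
  rewrite span_cons xbE; congr (_ + _)%VS.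
  apply/eqP; rewrite eqEsubv -!memvE memvZ ?memv_line//=.
  by rewrite -{1}[q](scalerK c0) memvZ ?memv_line.
rewrite -[_ :: _]cat1s orthonormal_cat; apply/and3P; split=> //.
  by rewrite /orthonormal /= !andbT cq.
apply/orthoPl => psi psib.
by rewrite dotZl (orthoPl qb psi psib) mulr0.
Qed.

Lemma orthonormal_span s u :
  orthonormal dot s -> u \in << s >>%VS -> u = \sum_(x <- s) '[u, x] *: x.
Proof.
move=> /orthonormalP[us os] /(@coord_span _ _ _ (in_tuple s)).
move=> uE.
have dE (i : 'I_(size s)) : '[u, s`_i] = coord (in_tuple s) i u.
  rewrite {1}uE dot_suml (bigD1 i) //= big1 => [|k ki].
    by rewrite dotZl os ?mem_nth // eqxx mulr1 addr0.
  rewrite dotZl os ?mem_nth // nth_uniq // val_eqE (negPf ki).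
  by rewrite mulr0.
rewrite {1}uE [RHS]big_tnth; apply: eq_bigr => i _.
by rewrite (tnth_nth 0) dE.
Qed.

Record onb s : Prop := Onb {
  onb_ortho : orthonormal dot s ;
  onb_expand : forall u, u = \sum_(x <- s) '[u, x] *: x ;
  onb_size : size s = \dim {:V} }.

Lemma onb_exists : exists s, onb s.
Proof.
have [s os sE] := Gram_Schmidt (vbasis {:V}).
have sT : (<< s >> = {:V})%VS by rewrite sE (span_basis (vbasisP _)).
exists s; split=> // [u|]; first by apply: orthonormal_span; rewrite ?sT ?memvf.
by rewrite -sT; apply/esym/eqP; exact: orthonormal_free os.
Qed.

Lemma Parseval s u v : onb s -> '[u, v] = \sum_(x <- s) '[u, x] * '[x, v].
Proof.
move=> os; rewrite {1}(onb_expand os u) dot_suml.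
by apply: eq_bigr => x _; rewrite dotZl.
Qed.

End OrthonormalBases.

Section Schur.
Context {R : realType} {G : topologicalGroupType}.
Notation C := R[i].
Notation unirep := (unitary_rep R G).
Implicit Types (pi sigma : unirep) (g : G).

Lemma rep_opK pi g : cancel (rep_op pi g) (rep_op pi g^-1%g).
Proof. by move=> u; rewrite -comp_lfunE -rep_opM mulVg rep_op1 id_lfunE. Qed.

Lemma rep_opVK pi g : cancel (rep_op pi g^-1%g) (rep_op pi g).
Proof. by move=> u; rewrite -comp_lfunE -rep_opM mulgV rep_op1 id_lfunE. Qed.

Lemma rep_adj pi g u v :
  rep_dot pi (rep_op pi g u) v = rep_dot pi u (rep_op pi g^-1%g v).
Proof. by rewrite -(rep_unitary g^-1%g) rep_opK. Qed.

Definition intertwines pi sigma (A : rep_space pi -> rep_space sigma) :=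
  forall g u, A (rep_op pi g u) = rep_op sigma g (A u).

Lemma eigenvector_exists (V : vectType C) (A : 'End(V)) : (0 < \dim {:V})%N ->
  exists (a : C) (w : V), w != 0 /\ A w = a *: w.
Proof.
move=> d0; have eb := vbasisP {:V}; set e := vbasis _ in eb.
have [a /eigenvalueP[v vM v0]] := eigenvalue_closed (passmx.mxof e e A) d0.
exists a, (passmx.vecof e v); split.
  by rewrite passmx.vecof_eq0 // basis_free.
rewrite (passmx.hom_vecof e eb) vM /passmx.vecof scaler_sumr.
by apply: eq_bigr => i _; rewrite mxE scalerA.
Qed.

(** Schur's lemma: an eigenspace of [A] is nonzero and invariant, hence the whole space. *)
Lemma irreducible_scalar pi (A : 'End(rep_space pi)) : irreducible pi ->
  @intertwines pi pi A -> exists c : C, forall u, A u = c *: u.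
Proof.
move=> [d0 irr] comA; have [a [w [w0 Aw]]] := eigenvector_exists A d0.
exists a => u; pose W := lker (A - a *: \1%VF).
have WP x : (x \in W) = (A x == a *: x).
  by rewrite memv_ker add_lfunE opp_lfunE scale_lfunE id_lfunE subr_eq0.
have [g||] := irr W; last first.
- by move=> WT; apply/eqP; rewrite -WP WT memvf.
- by move=> W0; move: w0; rewrite -memv0 -W0 WP Aw eqxx.
apply/subvP => _ /memv_imgP[x xW ->]; rewrite WP comA.
by rewrite WP in xW; rewrite (eqP xW) linearZ.
Qed.

Record sesquilinear pi sigma (b : rep_space pi -> rep_space sigma -> C) :
    Prop := Sesquilinear {
  sesqui_l : forall a u v w, b (a *: u + v) w = a * b u w + b v w ;
  sesqui_r : forall a u v w, b w (a *: u + v) = a^* * b w u + b w v }.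

Lemma sesqui_sumr pi sigma b (S : @sesquilinear pi sigma b) u I (r : seq I)
    (c : I -> C) (F : I -> rep_space sigma) :
  b u (\sum_(i <- r) c i *: F i) = \sum_(i <- r) (c i)^* * b u (F i).
Proof.
have b0 : b u 0 = 0.
  have := sesqui_r S 1 0 0 u; rewrite scale1r addr0 rmorph1 mul1r.
  by rewrite -[X in X = _]addr0 => /addrI.
by elim: r => [|i r IHr]; rewrite ?big_nil// !big_cons (sesqui_r S) IHr.
Qed.

(** Translates invariant forms into intertwining operators, so that Schur's lemma applies to
    integrals of products of matrix coefficients. *)
Lemma Riesz pi sigma b : @sesquilinear pi sigma b ->
  exists A : 'Hom(rep_space pi, rep_space sigma),
    forall u v, rep_dot sigma (A u) v = b u v.
Proof.
move=> S; have [s os] := onb_exists (rep_dot sigma).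
pose A u := \sum_(x <- s) b u x *: x.
have linA : linear A.
  move=> a u v; rewrite /A scaler_sumr -big_split; apply: eq_bigr => x _ /=.
  by rewrite (sesqui_l S) scalerDl scalerA.
pose A' := HB.pack_for {linear rep_space pi -> rep_space sigma} A
  (GRing.isLinear.Build _ _ _ _ A linA).
exists (linfun A') => u v; rewrite lfunE /= /A dot_suml.
rewrite [in RHS](onb_expand os v) (sesqui_sumr S); apply: eq_bigr => x _.
by rewrite dotZl mulrC [rep_dot _ x v]dotC.
Qed.

Definition invariant_form pi sigma (b : rep_space pi -> rep_space sigma -> C) :=
  forall g u v, b (rep_op pi g u) (rep_op sigma g v) = b u v.

Lemma Riesz_intertwines pi sigma b
    (A : 'Hom(rep_space pi, rep_space sigma)) :
  @invariant_form pi sigma b -> (forall u v, rep_dot sigma (A u) v = b u v) ->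
  intertwines A.
Proof.
move=> ib Ab g u; apply: (dot_ext (dot := rep_dot sigma)) => w.
by rewrite Ab rep_adj Ab -(ib g u) rep_opVK.
Qed.

Lemma invariant_form_scalar pi b : irreducible pi ->
  @sesquilinear pi pi b -> invariant_form b ->
  exists c, forall u v, b u v = c * rep_dot pi u v.
Proof.
move=> irr S ib; have [A Ab] := Riesz S.
have [c Ac] := irreducible_scalar irr (Riesz_intertwines ib Ab).
by exists c => u v; rewrite -Ab Ac dotZl.
Qed.

(** A nonzero form would give a nonzero intertwining operator [A]. The form <A u, A v> is then a
    positive multiple [q / p] of the inner product, and the image of [A] is invariant, hence
    everything; so [A] divided by the square root of [q / p] is a unitary equivalence. *)
Lemma inequivalent_form0 pi sigma b : irreducible pi -> irreducible sigma ->
  ~ unitarily_equivalent pi sigma ->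
  @sesquilinear pi sigma b -> invariant_form b -> forall u v, b u v = 0.
Proof.
move=> irrp irrs neq S ib; have [A Ab] := Riesz S.
have comA := Riesz_intertwines ib Ab.
have [A0 u v|/existsNP[u Au]] := pselect (forall u, A u = 0).
  by rewrite -Ab A0 linear0l.
exfalso; apply: neq.
pose b2 u v := rep_dot sigma (A u) (A v).
have S2 : @sesquilinear pi pi b2.
  by split=> a x y z; rewrite /b2 linearP ?dotDl ?dotZl ?dotDr ?dotZr.
have ib2 : @invariant_form pi pi b2.
  by move=> g x y; rewrite /b2 !comA rep_unitary.
have [c cE] := invariant_form_scalar irrp S2 ib2.
have u0 : u != 0 by apply/eqP => u0; apply: Au; rewrite u0 linear0.
pose p := complex.Re (rep_dot pi u u); pose q := complex.Re (b2 u u).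
have p0 : 0 < p by exact: dotvv_gt0.
have q0 : 0 < q by apply: dotvv_gt0; exact/eqP.
have cq : c = (q / p)%:C.
  have := cE u u; rewrite [LHS]dotvvE [in RHS]dotvvE -/p -/q => qp.
  rewrite rmorphM /= [q%:C]qp fmorphV /= mulfK //.
  by rewrite fmorph_eq0 gt_eqF.
pose r := Num.sqrt (q / p).
have r0 : r != 0 by rewrite gt_eqF// sqrtr_gt0 divr_gt0.
exists (r^-1%:C *: A); split.
- have Avz : limg A != 0%VS.
    by apply/eqP => A0; apply: Au; apply/eqP;
      rewrite -memv0 -A0 memv_img ?memvf.
  have -> : limg (r^-1%:C *: A) = limg A.
    apply/vspaceP => z; apply/memv_imgP/memv_imgP => -[y _ ->].
      by exists (r^-1%:C *: y); rewrite ?memvf// scale_lfunE linearZ.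
    exists (r%:C *: y); rewrite ?memvf// scale_lfunE linearZ scalerA -rmorphM.
    by rewrite mulVf// scale1r.
  have [g||//] := irrs.2 (limg A); last by move=> A0; rewrite A0 eqxx in Avz.
  apply/subvP => _ /memv_imgP[_ /memv_imgP[y _ ->] ->].
  by rewrite -comA memv_img ?memvf.
- move=> x y; rewrite !scale_lfunE dotZl dotZr conjc_realE -/(b2 x y) cE cq.
  rewrite !mulrA -!rmorphM /= -invfM -expr2 sqr_sqrtr ?divr_ge0 1?ltW//.
  by rewrite mulVf ?mul1r// gt_eqF// divr_gt0.
- by move=> g x; rewrite !scale_lfunE comA linearZ.
Qed.

End Schur.

(** * Matrix coefficients *)

Section MatrixCoefficients.
Context {R : realType} {G : topologicalGroupType} {K : ptopologicalType}.
Context {act : G -> K -> K}.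
Notation C := R[i].
Notation unirep := (unitary_rep R G).
Variable mu : probability (borel K) R.
Variable x0 : K.
Hypothesis cG : compact [set: G].
Hypothesis hK : homogeneous_space act.
Hypothesis inv : invariant_measure act mu.
Implicit Types (pi sigma : unirep) (g : G).

Let cK : compact [set: K] := space_compact hK.

Lemma continuous_orbit_map : continuous (fun g => act g x0).
Proof.
move=> g; have H : continuous (fun p : G * K => act p.1 p.2).
  exact: act_continuous hK.
apply: (@cvg_comp _ _ _ (fun g => (g, x0)) (fun p => act p.1 p.2) _ (nbhs (g,
  x0))).
  by apply: cvg_pair => /=; [exact: cvg_id|exact: cvg_cst].
exact: (H (g, x0)).
Qed.

(* The orbit map [g |-> act g x0] is closed, hence a quotient map. *)
Lemma ccont_orbit (f : K -> C) : ccont (fun g => f (act g x0)) -> ccont f.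
Proof.
move=> cf; split=> x e e0.
pose E := [set g | e <= normc (f x - f (act g x0))].
have cE : closed E.
  have /rcontP/continuous_closedP := rcont_normc (ccontB (ccont_cst (f x)) cf).
  by move=> /(_ [set t | e <= t]); apply; exact: closed_ge.
have : closed ((fun g => act g x0) @` E).
  apply: compact_closed; first exact: space_hausdorff hK.
  apply: continuous_compact.
    by apply: continuous_subspaceT => g; exact: continuous_orbit_map.
  by apply: subclosed_compact cE cG _.
rewrite -openC => oE.
have Nx : (~` ((fun g => act g x0) @` E)) x.
  by move=> [g Eg gx]; move: Eg; rewrite /E /= gx subrr normc0 leNgt e0.
have := open_nbhs_nbhs (conj oE Nx).
apply: filterS => y Ny; rewrite ltNge; apply/negP => ey; apply: Ny.
have [g gy] := act_transitive hK x0 y.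
by exists g => //; rewrite /E /= gy.
Qed.

Lemma rep_coef_cont pi (u v : rep_space pi) :
  ccont (fun g => rep_dot pi v (rep_op pi g u)).
Proof.
split=> g e e0; pose p := complex.Re (rep_dot pi v v).
have p0 : 0 <= p by have := dnorm_ge0 (rep_dot pi) v; rewrite dotvvE lecR.
have p1 : 0 < p + 1 by rewrite ltr_wpDl.
(* The radius comes from Cauchy-Schwarz, with [p] the squared norm of [v]; the summand 1 covers
   [v = 0]. *)
have d0 : 0 < e ^+ 2 / (p + 1) by rewrite divr_gt0 ?exprn_gt0.
have /cvgrPdist_lt/(_ (e ^+ 2 / (p + 1))%:C) := @rep_continuous _ _ pi u g.
rewrite ltcR => /(_ d0); apply: filterS => g'.
set w := rep_op pi g' u - rep_op pi g u.
rewrite sub0r normrN dotvvE normcE normc_real ltcR => wd.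
have {}wd := le_lt_trans (ler_norm _) wd.
have -> : rep_dot pi v (rep_op pi g u) - rep_dot pi v (rep_op pi g' u) =
    - rep_dot pi v w by rewrite dotBr opprB.
rewrite normcN -(ltr_pXn2r (n := 2)) ?nnegrE ?normc_ge0// ?ltW//.
have := (CauchySchwarz (rep_dot pi) v w).1.
rewrite [rep_dot pi v v]dotvvE [rep_dot pi w w]dotvvE normcE -rmorphXn -rmorphM
  lecR.
move=> /le_lt_trans; apply; rewrite -/p.
rewrite ltr_pdivlMr // in wd; apply: le_lt_trans wd.
rewrite mulrDr mulr1 mulrC lerDl.
by have := dnorm_ge0 (rep_dot pi) w; rewrite dotvvE lecR.
Qed.

Notation fixed := (fixed_vectors act x0).
Notation coef := (matrix_coef act x0).

Lemma coef_cont pi (u v : rep_space pi) : fixed u -> ccont (coef u v).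
Proof.
move=> fu; apply: ccont_orbit.
under eq_fun do rewrite matrix_coefE //.
exact: rep_coef_cont.
Qed.

Lemma coef_translate pi (u v : rep_space pi) g : fixed u ->
  translate act g (coef u v) = coef u (rep_op pi g v).
Proof.
move=> fu; apply/funext => x; have [t <-] := act_transitive hK x0 x.
rewrite /translate -(actM hK) !matrix_coefE // rep_adj -comp_lfunE.
by rewrite -rep_opM.
Qed.

Lemma coef_x0 pi (u v : rep_space pi) : fixed u -> coef u v x0 = rep_dot pi v u.
Proof.
move=> fu; have := @matrix_coefE _ _ _ act x0 pi u v 1%g hK fu.
by rewrite (act1 hK) rep_op1 id_lfunE.
Qed.

Section Orthogonality.
Variables (pi sigma : unirep) (u : rep_space pi) (u' : rep_space sigma).
Hypotheses (fu : fixed u) (fu' : fixed u').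

Let b (v : rep_space pi) (v' : rep_space sigma) : C :=
  dotL2 mu (coef u v) (coef u' v').

Let cb v v' : ccont (fun x => coef u v x * (coef u' v' x)^*).
Proof. by apply: ccontM; [exact: coef_cont|apply: ccontJ;
  exact: coef_cont]. Qed.

Lemma coef_form : sesquilinear b.
Proof.
split=> a v w z; rewrite /b /dotL2 -!/(cint _ _).
  have -> : (fun x => coef u (a *: v + w) x * (coef u' z x)^*) =
      fun x => a * (coef u v x * (coef u' z x)^*) + coef u w x * (coef u' z
        x)^*.
    by apply/funext => x; rewrite /matrix_coef dotDl dotZl mulrDl mulrA.
  by rewrite (cintD mu cK (ccontZ a (cb v z)) (cb w z)) (cintZ mu cK a (cb v
    z)).
have -> : (fun x => coef u z x * (coef u' (a *: v + w) x)^*) =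
    fun x => a^* * (coef u z x * (coef u' v x)^*) + coef u z x * (coef u' w
      x)^*.
  apply/funext => x; rewrite /matrix_coef dotDl dotZl rmorphD rmorphM mulrDr.
  by rewrite mulrCA.
by rewrite (cintD mu cK (ccontZ a^* (cb z v)) (cb z w)) (cintZ mu cK a^* (cb z
  v)).
Qed.

Lemma coef_form_invariant : invariant_form b.
Proof.
move=> g v v'; rewrite /b -!coef_translate // /dotL2 -!/(cint _ _).
exact: (cint_act hK inv g^-1%g (cb v v')).
Qed.

End Orthogonality.

Lemma coef_orthogonal pi sigma (u v : rep_space pi) (u' v' : rep_space sigma) :
  irreducible pi -> irreducible sigma -> ~ unitarily_equivalent pi sigma ->
  fixed u -> fixed u' -> dotL2 mu (coef u v) (coef u' v') = 0.
Proof.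
move=> irrp irrs neq fu fu'.
exact: (inequivalent_form0 irrp irrs neq (coef_form fu fu')
          (coef_form_invariant fu fu')).
Qed.

(** By Schur the form is [c] times the inner product. Summing its diagonal over an orthonormal basis
    gives d_pi times [c]; the corresponding sum of integrands is constant on [K], by Parseval and
    unitarity, which identifies [c]. *)
Lemma coef_orthogonality pi (u v u' v' : rep_space pi) :
  irreducible pi -> fixed u -> fixed u' ->
  (rep_dim pi)%:R * dotL2 mu (coef u v) (coef u' v') =
  rep_dot pi v v' * rep_dot pi u' u.
Proof.
move=> irr fu fu'.
have [c cE] := invariant_form_scalar irr (coef_form fu fu')
          (coef_form_invariant fu fu').
rewrite cE mulrA [RHS]mulrC; congr (_ * _).
have [s os] := onb_exists (rep_dot pi).
have -> : (rep_dim pi)%:R * c =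
    \sum_(w <- s) dotL2 mu (coef u w) (coef u' w).
  rewrite (eq_bigr (fun w => c * rep_dot pi w w)) => [|w _]; last exact: cE.
  rewrite -big_distrr /= mulrC; congr (_ * _).
  rewrite /rep_dim -(onb_size os) big_seq (eq_bigr (fun=> 1)) => [|w ws].
    by rewrite -big_seq big_const_seq count_predT iter_addr_0.
  by have /orthonormalP[_ ->] := onb_ortho os; rewrite ?eqxx.
have cw w : ccont (fun x => coef u w x * (coef u' w x)^*).
  by apply: ccontM; [exact: coef_cont|apply: ccontJ; exact: coef_cont].
rewrite /dotL2 -(cint_sum mu cK _ cw).
have -> : (fun x => \sum_(w <- s) coef u w x * (coef u' w x)^*) =
    fun=> rep_dot pi u' u; last exact: cint_cst.
apply/funext => x; rewrite /matrix_coef; set t := transporter _ _ _.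
rewrite -(rep_unitary t) (Parseval _ _ os); apply: eq_bigr => w _.
by rewrite mulrC -dotC.
Qed.

End MatrixCoefficients.

Lemma fun_sumE {R : realType} {K : Type} {I : Type} (r : seq I) (c : I -> R[i])
    (F : I -> K -> R[i]) :
  \sum_(i <- r) c i *: F i = fun x => \sum_(i <- r) c i * F i x.
Proof. by apply/funext => x; rewrite fct_sumE. Qed.

Definition subspace_closed {R : realType} {K : Type} (S : set (K -> R[i])) :=
  S (fun=> 0) /\ forall a f g, S f -> S g -> S (fun x => a * f x + g x).

Lemma subspace_sum {R : realType} {K I : Type} (S : set (K -> R[i]))
    (r : seq I) (c : I -> R[i]) (F : I -> K -> R[i]) : subspace_closed S ->
  (forall i, S (F i)) -> S (fun x => \sum_(i <- r) c i * F i x).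
Proof.
move=> [S0 SP] SF; elim: r => [|i r IHr].
  by under eq_fun do rewrite big_nil.
by under eq_fun do rewrite big_cons; exact: SP.
Qed.

(** Any finite index type is allowed because the basis in [S_basis] is indexed by dependent triples
    (representation, fixed vector, basis vector). *)
Definition fspan {R : realType} {K : Type} {J : finType} (e : J -> K -> R[i]) :
  set (K -> R[i]) := [set f | exists c, f = fun x => \sum_j c j * e j x].

Lemma fspan_closed {R : realType} {K : Type} {J : finType}
  (e : J -> K -> R[i]) : subspace_closed (fspan e).
Proof.
split=> [|a f g [c ->] [d ->]].
  by exists (fun=> 0); apply/funext => x; rewrite big1 // => j _; rewrite mul0r.
exists (fun j => a * c j + d j); apply/funext => x.
rewrite mulr_sumr -big_split; apply: eq_bigr => j _ /=.
by rewrite mulrDl mulrA.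
Qed.

Lemma fspan_mem {R : realType} {K : Type} {J : finType}
  (e : J -> K -> R[i]) j : fspan e (e j).
Proof.
exists (fun i => (i == j)%:R); apply/funext => x.
rewrite (bigD1 j) //= eqxx mul1r big1 ?addr0 // => i /negPf ->.
by rewrite mul0r.
Qed.

Lemma linear_span_sub {R : realType} {K : Type} (A S : set (K -> R[i])) :
  subspace_closed S -> A `<=` S -> linear_span A `<=` S.
Proof.
move=> cS AS f [n [c [a [Aa ->]]]]; rewrite fun_sumE.
by apply: subspace_sum => // i; exact/AS.
Qed.

(** * The space [S]: stability under equivariant maps, and an orthonormal basis *)

Section CoefficientSpaces.
Context {R : realType} {G : topologicalGroupType} {K : ptopologicalType}.
Context {act : G -> K -> K}.
Notation C := R[i].
Variable mu : probability (borel K) R.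
Variable x0 : K.
Hypothesis cG : compact [set: G].
Hypothesis hK : homogeneous_space act.
Hypothesis inv : invariant_measure act mu.
Context {Lambda : finType}.
Variable pi : Lambda -> unitary_rep R G.
Variable u : forall i : Lambda, seq (rep_space (pi i)).
Hypothesis pi_irreducible : forall i, irreducible (pi i).
Hypothesis pi_inequivalent : forall i j, i != j ->
  ~ unitarily_equivalent (pi i) (pi j).
Hypothesis u_basis : forall i, fixed_basis act x0 (u i).

Notation fixed := (fixed_vectors act x0).
Notation coef := (matrix_coef act x0).
Notation S := (sum_spaces (fun i => Epi act x0 (pi i))).

Let cK : compact [set: K] := space_compact hK.

Lemma Epi_coef i (w v : rep_space (pi i)) : fixed w ->
  Epi act x0 (pi i) (coef w v).
Proof.
move=> fw; exists 1%N, (fun=> 1), (fun=> coef w v); split.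
  by move=> _; exists w, v.
by rewrite big_ord1 scale1r.
Qed.

Lemma Epi_closed i : subspace_closed (Epi act x0 (pi i)).
Proof.
split; first by exists 0%N, (fun=> 0), (fun=> 0); split=> [[]|]//;
  rewrite big_ord0.
move=> a f g [n [c [F [EF ->]]]] [m [d [H [EH ->]]]].
exists (n + m)%N, (fun k => match fintype.split k with inl l => a * c l | inr l
  => d l end),
  (fun k => match fintype.split k with inl l => F l | inr l => H l end);
    split=> [k|].
  by case: fintype.split.
rewrite !fun_sumE; apply/funext => x; rewrite big_split_ord mulr_sumr.
congr (_ + _); apply: eq_bigr => k _ /=.
  by have -> : fintype.split (lshift m k) = inl k := unsplitK (inl k);
    rewrite mulrA.
by have -> : fintype.split (rshift n k) = inr k := unsplitK (inr k).
Qed.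

Lemma sum_spaces_closed : subspace_closed S.
Proof.
split.
  exists (fun _ _ => 0); split; first by move=> i; exact: (Epi_closed i).1.
  by apply/funext => x; rewrite fct_sumE big1.
move=> a f g [F [SF ->]] [H [SH ->]].
exists (fun i x => a * F i x + H i x); split=> [i|].
  exact: (Epi_closed i).2.
apply/funext => x; rewrite !fct_sumE mulr_sumr -big_split.
by [].
Qed.

Lemma Epi_sub i : Epi act x0 (pi i) `<=` S.
Proof.
move=> f Ef; exists (fun j => if j == i then f else fun=> 0); split=> [j|].
  by case: eqP => [->//|_]; exact: (Epi_closed j).1.
rewrite (bigD1 i) //= eqxx big1 ?addr0 // => j /negPf -> //.
Qed.

(** The induction principle for [S]: a property stable under linear combinations need only be
    checked on matrix coefficients. *)
Lemma sum_spaces_sub (T : set (K -> C)) : subspace_closed T ->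
  (forall i (w v : rep_space (pi i)), fixed w -> T (coef w v)) -> S `<=` T.
Proof.
move=> cT Tc f [F [SF ->]].
have TF i : T (F i).
  apply: linear_span_sub (SF i) => // _ [w [v [fw ->]]]; exact: Tc.
have -> : \sum_i F i = fun x => \sum_i 1 * F i x.
  by apply/funext => x; rewrite fct_sumE; apply: eq_bigr => i _; rewrite mul1r.
exact: subspace_sum.
Qed.

Lemma S_translate g f : S f -> S (translate act g f).
Proof.
have [S0 SP] := sum_spaces_closed.
apply: (@sum_spaces_sub [set f | S (translate act g f)]) f.
  by split=> [|a f h Sf Sh]; [exact: S0|exact: SP].
move=> i w v fw /=; rewrite coef_translate //.
by apply: (@Epi_sub i); exact: Epi_coef.
Qed.

(* An equivariant map sends [v |-> <v, pi(.) u>] to another equivariant map *)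
(* [V -> C(K)], and evaluation at [x0] shows that it is again of this form.   *)
Lemma equivariant_stable (T : (K -> C) -> K -> C) :
  (forall a f h, S f -> S h ->
    T (fun x => a * f x + h x) = fun x => a * T f x + T h x) ->
  (forall g f, S f -> T (translate act g f) = translate act g (T f)) ->
  forall f, S f -> S (T f).
Proof.
move=> linT eqT; have [S0 SP] := sum_spaces_closed.
have T0 : T (fun=> 0) = fun=> 0.
  have := linT (-1) (fun=> 0) (fun=> 0) S0 S0.
  rewrite (_ : (fun=> -1 * 0 + 0) = fun=> 0); last by apply/funext => x;
    rewrite mulr0 addr0.
  by move=> ->; apply/funext => x; rewrite mulN1r addNr.
(* Membership in [S] is carried along because [T] is assumed linear only on [S]. *)
move=> f Sf; suff [] : S f /\ S (T f) by [].
move: f Sf; apply: sum_spaces_sub => [|i w v fw].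
  split; first by rewrite /= T0.
  move=> a f h [Sf STf] [Sh STh]; split; first exact: SP.
  by rewrite linT //; exact: SP.
have Sc v' : S (coef w v') by apply: (@Epi_sub i); exact: Epi_coef.
split; first exact: Sc.
have [s os] := onb_exists (rep_dot (pi i)).
pose J v' := T (coef w v') x0.
(* The Riesz vector of the linear functional [J]; the conjugates appear because the inner product is
   antilinear in its second argument. *)
pose w' := \sum_(x <- s) (J x)^* *: x.
have JE v' : J v' = rep_dot (pi i) v' w'.
  rewrite {1}(onb_expand os v') /w' dot_sumr.
  have JS (r : seq (rep_space (pi i))) (c : rep_space (pi i) -> C) :
      J (\sum_(x <- r) c x *: x) = \sum_(x <- r) c x * J x.
    elim: r => [|x r IHr].
      rewrite !big_nil /J (_ : coef w 0 = fun=> 0) ?T0 //.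
      by apply/funext => x; rewrite /matrix_coef linear0l.
    rewrite !big_cons -IHr /J -[RHS]/((fun y => c x * T (coef w x) y +
      T (coef w (\sum_(j <- r) c j *: j)) y) x0) -linT //; congr (T _ _).
    by apply/funext => y; rewrite /matrix_coef dotDl dotZl.
  rewrite JS; apply: eq_bigr => x _.
  by rewrite dotZr (conjCK (C := R[i])) mulrC.
have TE g v' : T (coef w v') (act g x0) = rep_dot (pi i) v' (rep_op (pi i) g
  w').
  have := eqT g^-1%g _ (Sc v');
    rewrite coef_translate // => /(congr1 (fun f => f x0)).
  by rewrite -[LHS]/(J _) JE /translate invgK rep_adj invgK => <-.
(* An element [h] that fixes [x0] does not change the value at [x0], which by [TE] is the pairing
   with [w']. *)
have fw' : fixed w'.
  move=> h hx0; apply: (dot_ext (dot := rep_dot (pi i))) => v'.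
  by rewrite dotC -TE hx0 -/(J v') JE -dotC.
have -> : T (coef w v) = coef w' v.
  apply/funext => x; have [g <-] := act_transitive hK x0 x.
  by rewrite TE matrix_coefE.
by apply: (@Epi_sub i); exact: Epi_coef.
Qed.

(** The basis consists of the coefficients of orthonormal vectors [U i l] and [B i k], scaled by the
    square root of d_pi. In the kernel at [x0] the sum over [k] is a Parseval expansion, and what
    remains is the spherical character. *)
Lemma S_basis : exists (J : finType) (e : J -> K -> C),
  [/\ forall j, ccont (e j),
      forall i j, dotL2 mu (e i) (e j) = (i == j)%:R,
      S = fspan e &
      forall x, \sum_j (e j x0)^* * e j x =
        \sum_i (rep_dim (pi i))%:R * spherical_character act x0 (u i) x].
Proof.
have [b ob] : exists b : forall i, seq (rep_space (pi i)),
    forall i, onb (rep_dot (pi i)) (b i).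
  exists (fun i => projT1 (cid (onb_exists (rep_dot (pi i))))) => i.
  by case: cid.
pose J := {i : Lambda & ('I_(size (u i)) * 'I_(size (b i)))%type}.
pose U i (l : 'I_(size (u i))) := (u i)`_l.
pose B i (k : 'I_(size (b i))) := (b i)`_k.
have fU i l : fixed (U i l).
  by rewrite (u_basis i).2 /=; apply: memv_span; exact: mem_nth.
pose sd i : R := Num.sqrt (rep_dim (pi i))%:R.
have sd2 i : (sd i)%:C * (sd i)%:C = (rep_dim (pi i))%:R.
  by rewrite -rmorphM -expr2 sqr_sqrtr ?ler0n// rmorph_nat.
have d0 i : (rep_dim (pi i))%:R != 0 :> C.
  by rewrite pnatr_eq0 -lt0n; have [] := pi_irreducible i.
have sd0 i : (sd i)%:C != 0.
  by apply: contraNneq (d0 i) => sd0; rewrite -sd2 sd0 mulr0.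
pose e (j : J) x :=
  (sd (tag j))%:C * coef (U _ (tagged j).1) (B _ (tagged j).2) x.
have oU i l l' : rep_dot (pi i) (U i l) (U i l') = (l == l')%:R.
  have /orthonormalP[us os] := (u_basis i).1.
  by rewrite os ?mem_nth // nth_uniq.
have oB i k k' : rep_dot (pi i) (B i k) (B i k') = (k == k')%:R.
  have /orthonormalP[us os] := onb_ortho (ob i).
  by rewrite os ?mem_nth // nth_uniq.
exists J, e; split.
- by move=> j; apply: ccontZ; exact: coef_cont.
- move=> [i [l k]] [i' [l' k']]; rewrite /e /=.
  have cc : ccont (fun x => coef (U i l) (B i k) x * (coef (U i' l') (B i' k')
    x)^*).
    by apply: ccontM; [exact: coef_cont|apply: ccontJ; exact: coef_cont].
  have -> : dotL2 mu (fun x => (sd i)%:C * coef (U i l) (B i k) x)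
        (fun x => (sd i')%:C * coef (U i' l') (B i' k') x) =
      (sd i)%:C * (sd i')%:C * dotL2 mu (coef (U i l) (B i k)) (coef (U i' l')
        (B i' k')).
    rewrite /dotL2 -!/(cint _ _) -(cintZ mu cK _ cc); congr cint.
    by apply/funext => x; rewrite rmorphM /= conjc_realE mulrACA.
  have [ii'|ii'] := eqVneq i i'; last first.
    rewrite coef_orthogonal ?mulr0 //; last exact: pi_inequivalent.
    by have [[] /esym/eqP|] := eqVneq;
      rewrite ?(negPf ii') // eq_sym (negPf ii').
  case: i' / ii' l' k' cc => l' k' _; rewrite sd2 coef_orthogonality // oU oB.
  rewrite -natrM mulnb -[(existT _ i _ == _)]/(_ == _) eq_Tagged /=.
  by rewrite xpair_eqE andbC [l' == _]eq_sym.
- apply/seteqP; split.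
    apply: sum_spaces_sub; first exact: fspan_closed.
    move=> i w v fw.
    have wE : w = \sum_l rep_dot (pi i) w (U i l) *: U i l.
      have wu : w \in (<< u i >>)%VS by have := fw; rewrite (u_basis i).2.
      rewrite {1}(orthonormal_span (u_basis i).1 wu) big_tnth.
      by apply: eq_bigr => l _; rewrite !(tnth_nth 0).
    have vE : v = \sum_k rep_dot (pi i) v (B i k) *: B i k.
      rewrite {1}(onb_expand (ob i) v) big_tnth.
      by apply: eq_bigr => k _; rewrite !(tnth_nth 0).
    have -> : coef w v = fun x => \sum_p ((rep_dot (pi i) w (U i p.1))^* *
        rep_dot (pi i) v (B i p.2) / (sd i)%:C) * e (existT _ i p) x.
      apply/funext => x.
      rewrite (eq_bigr (fun p => (rep_dot (pi i) w (U i p.1))^* *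
        (rep_dot (pi i) v (B i p.2) * coef (U i p.1) (B i p.2) x))); last first.
        by move=> p _; rewrite /e /= mulrA mulfVK // mulrA.
      rewrite -(pair_bigA _ (fun l k => (rep_dot (pi i) w (U i l))^* *
        (rep_dot (pi i) v (B i k) * coef (U i l) (B i k) x))) /=.
      rewrite {1}/matrix_coef {1}wE linear_sum dot_sumr; apply: eq_bigr => l _.
      rewrite linearZ dotZr -mulr_sumr; congr (_ * _).
      by rewrite {1}vE dot_suml; apply: eq_bigr => k _; rewrite dotZl.
    by apply: subspace_sum => [|p]; [exact: fspan_closed|exact: fspan_mem].
  move=> _ [c ->]; apply: subspace_sum; first exact: sum_spaces_closed.
  move=> [i [l k]]; apply: (@Epi_sub i); rewrite /e /=.
  have := (Epi_closed i).2 (sd i)%:C _ _ (Epi_coef (B i k) (fU i l))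
    (Epi_closed i).1.
  by under eq_fun do rewrite addr0.
- move=> x; pose F i p := (e (existT _ i p) x0)^* * e (existT _ i p) x.
  transitivity (\sum_i \sum_p F i p).
    rewrite (sig_big_dep (fun=> true) (fun _ _ => true) F) /=.
    by apply: eq_bigr => -[].
  apply: eq_bigr => i _; rewrite -(pair_bigA _ (fun l k => F i (l, k))) /=.
  rewrite /spherical_character [in RHS]big_tnth mulr_sumr;
    apply: eq_bigr => l _.
  rewrite (tnth_nth 0) /= -/(U i l) (Parseval _ _ (ob i)) [in RHS]big_tnth
    mulr_sumr.
  apply: eq_bigr => k _; rewrite (tnth_nth 0) /= -/(B i k) -sd2 /F /e /=.
  rewrite rmorphM /= conjc_realE coef_x0 // -dotC -mulrACA.
  by rewrite mulrA.
Qed.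

End CoefficientSpaces.

(** * Equivariant operators *)

Section EquivariantProjections.
Context {R : realType} {G : topologicalGroupType} {K : ptopologicalType}.
Context {act : G -> K -> K}.
Notation C := R[i].
Variable mu : probability (borel K) R.
Hypothesis cG : compact [set: G].
Hypothesis hK : homogeneous_space act.
Hypothesis inv : invariant_measure act mu.
Context {J : finType}.
Variable e : J -> K -> C.
Hypothesis ce : forall j, ccont (e j).
Hypothesis oe : forall i j, dotL2 mu (e i) (e j) = (i == j)%:R.
Notation S := (fspan e).
Hypothesis S_inv : forall g f, S f -> S (translate act g f).
Hypothesis S_stable : forall T : (K -> C) -> K -> C,
  (forall a f h, S f -> S h ->
    T (fun x => a * f x + h x) = fun x => a * T f x + T h x) ->
  (forall g f, S f -> T (translate act g f) = translate act g (T f)) ->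
  forall f, S f -> S (T f).
Implicit Types (f h : K -> C) (Phi : K -> K -> C) (g : G).

Let cK : compact [set: K] := space_compact hK.

Notation dot := (dotL2 mu).

Lemma fspan_ccont f : S f -> ccont f.
Proof. by move=> [c ->]; apply: ccont_sum => j; exact: ccontZ. Qed.

Lemma ccont_mulJ f h : ccont f -> ccont h -> ccont (fun x => f x * (h x)^*).
Proof. by move=> cf ch; exact: ccontM cf (ccontJ ch). Qed.

Lemma dotL2_linear a f h s : ccont f -> ccont h -> ccont s ->
  dot (fun x => a * f x + h x) s = a * dot f s + dot h s.
Proof.
move=> cf ch cs; rewrite /dotL2 -!/(cint _ _).
have [c1 c2] := (ccont_mulJ cf cs, ccont_mulJ ch cs).
rewrite -(cintZ mu cK a c1) -(cintD mu cK (ccontZ a c1) c2).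
by congr cint; apply/funext => x; rewrite mulrDl mulrA.
Qed.

Lemma dotL2B f h s : ccont f -> ccont h -> ccont s ->
  dot (fun x => f x - h x) s = dot f s - dot h s.
Proof.
move=> cf ch cs; rewrite -[dot h s]mul1r -mulNr addrC -(dotL2_linear _ ch cf
  cs).
by congr dotL2; apply/funext => x; rewrite mulN1r addrC.
Qed.

Lemma dotL2_sumr f (c : J -> C) : ccont f ->
  dot f (fun x => \sum_j c j * e j x) = \sum_j (c j)^* * dot f (e j).
Proof.
move=> cf; have cj j := ccont_mulJ cf (ce j); rewrite /dotL2 -!/(cint _ _).
rewrite (eq_bigr (fun j => cint mu (fun x => (c j)^* * (f x * (e j x)^*)))).
  rewrite -(cint_sum mu cK _ (fun j => ccontZ (c j)^* (cj j))).
  congr cint; apply/funext => x; rewrite conjc_sum mulr_sumr.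
  by apply: eq_bigr => j _; rewrite conjcM mulrCA.
by move=> j _; rewrite (cintZ mu cK _ (cj j)).
Qed.

Lemma dotL2_suml f (c : J -> C) : ccont f ->
  dot (fun x => \sum_j c j * e j x) f = \sum_j c j * dot (e j) f.
Proof.
move=> cf; have cj j := ccont_mulJ (ce j) cf; rewrite /dotL2 -!/(cint _ _).
rewrite (eq_bigr (fun j => cint mu (fun x => c j * (e j x * (f x)^*)))).
  rewrite -(cint_sum mu cK _ (fun j => ccontZ (c j) (cj j))).
  congr cint; apply/funext => x; rewrite mulr_suml.
  by apply: eq_bigr => j _; rewrite mulrA.
by move=> j _; rewrite (cintZ mu cK _ (cj j)).
Qed.

Definition oproj f x := \sum_j dot f (e j) * e j x.

Lemma oproj_fspan f : S (oproj f).
Proof. by exists (fun j => dot f (e j)). Qed.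

Lemma oproj_id f : S f -> oproj f = f.
Proof.
move=> [c ->]; apply/funext => x; apply: eq_bigr => j _; congr (_ * _).
rewrite dotL2_suml // (bigD1 j) //= oe eqxx mulr1 big1 ?addr0 // => i ij.
by rewrite oe (negPf ij) mulr0.
Qed.

Lemma fspan_expand f x : S f -> f x = \sum_j dot f (e j) * e j x.
Proof. by move=> Sf; rewrite -{1}(oproj_id Sf). Qed.

Lemma fspan_orthogonal_eq0 f : S f -> (forall s, S s -> dot f s = 0) ->
  f = fun=> 0.
Proof.
move=> Sf f0; rewrite -(oproj_id Sf); apply/funext => x; apply: big1 => j _.
by rewrite f0 ?mul0r //; exact: fspan_mem.
Qed.

Definition rkernel y x := \sum_j (e j y)^* * e j x.

Lemma rkernel_cont : kcont rkernel.
Proof.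
apply: (@ccont_sum _ _ _ _ (fun j (p : K * K) => (e j p.1)^* * e j p.2)) => j.
by apply: ccontM; [apply: ccontJ; exact: kcont_fst|exact: kcont_snd].
Qed.

Lemma rkernelC y x : (rkernel y x)^* = rkernel x y.
Proof.
rewrite /rkernel conjc_sum; apply: eq_bigr => j _.
by rewrite conjcM conjcKK mulrC.
Qed.

Lemma rkernel_fspan y : S (rkernel y).
Proof. by exists (fun j => (e j y)^*). Qed.

Lemma oprojE f x : ccont f -> oproj f x = cint mu (fun y => f y * rkernel y x).
Proof.
move=> cf; have cj j := ccont_mulJ cf (ce j); rewrite /oproj.
rewrite (eq_bigr (fun j => cint mu (fun y => e j x * (f y * (e j y)^*)))).
  rewrite -(cint_sum mu cK _ (fun j => ccontZ (e j x) (cj j))).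
  congr cint; apply/funext => y; rewrite /rkernel mulr_sumr.
  by apply: eq_bigr => j _; rewrite mulrC mulrA.
by move=> j _; rewrite (cintZ mu cK _ (cj j)) mulrC.
Qed.

Lemma rkernel_reproducing f y : S f -> dot f (rkernel y) = f y.
Proof.
move=> Sf; rewrite -{2}(oproj_id Sf) (oprojE _ (fspan_ccont Sf)).
by rewrite /dotL2; congr cintegral; apply/funext => x; rewrite rkernelC.
Qed.

Lemma translate_ccont g f : ccont f -> ccont (translate act g f).
Proof. by move=> cf; exact: (ccont_act hK g^-1%g cf). Qed.

Lemma dotL2_translate g f h : ccont f -> ccont h ->
  dot (translate act g f) (translate act g h) = dot f h.
Proof.
move=> cf ch; exact: (cint_act hK inv g^-1%g (ccont_mulJ cf ch)).
Qed.

Lemma translateVK g f : translate act g (translate act g^-1%g f) = f.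
Proof. by apply/funext => x; rewrite /translate invgK actVK. Qed.

(** The reproducing property determines the kernel within [S], and translation is unitary on [S], so
    the translated kernel reproduces as well. *)
Lemma rkernel_inv : kinv act rkernel.
Proof.
move=> g y x; pose h := translate act g^-1%g (rkernel (act g y)).
have Sh : S h by apply: S_inv; exact: rkernel_fspan.
suff /(congr1 (fun f => f x)) : (fun x => h x - rkernel y x) = fun=> 0.
  by rewrite /h /translate invgK => /eqP; rewrite subr_eq0 => /eqP.
have ch := fspan_ccont Sh; have Sk := rkernel_fspan y.
have ck := fspan_ccont Sk.
apply: fspan_orthogonal_eq0 => [|s Ss].
  have [_ SP] := fspan_closed e; have := SP (-1) _ _ Sk Sh.
  by under eq_fun do rewrite mulN1r addrC.
have cs := fspan_ccont Ss.
rewrite (dotL2B ch ck cs); apply/eqP; rewrite subr_eq0; apply/eqP.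
have dJ (f1 f2 : K -> C) : ccont f1 -> ccont f2 -> dot f1 f2 = (dot f2 f1)^*.
  move=> c1 c2; rewrite /dotL2 -!/(cint _ _) -(cintJ mu cK (ccont_mulJ c2 c1)).
  congr cint; apply/funext => z.
  by rewrite conjcM conjcKK mulrC.
rewrite (dJ _ _ ch cs) (dJ _ _ ck cs) rkernel_reproducing //; congr (_^*).
rewrite -(dotL2_translate g cs ch) translateVK rkernel_reproducing.
  by rewrite /translate actK.
exact: S_inv.
Qed.

Lemma oproj_translate g f : ccont f ->
  oproj (translate act g f) = translate act g (oproj f).
Proof.
move=> cf; apply/funext => x; rewrite {2}/translate.
rewrite (oprojE _ (translate_ccont g cf)) (oprojE _ cf).
have ck : ccont (fun y => f y * rkernel y (act g^-1%g x)).
  exact: ccontM cf (kcont_l _ rkernel_cont).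
rewrite -(cint_act hK inv g^-1%g ck); congr cint; apply/funext => y.
by rewrite rkernel_inv.
Qed.

Record bounded_operator (Q : (K -> C) -> K -> C) : Prop := BoundedOperator {
  bo_range : forall f, ccont f -> S (Q f) ;
  bo_linear : forall a f h, ccont f -> ccont h ->
    Q (fun x => a * f x + h x) = fun x => a * Q f x + Q h x ;
  bo_bounded : exists2 M : R, 0 <= M & forall f x, ccont f ->
    normc (Q f x) <= M * supnorm f }.

Lemma bo_eval Q x : bounded_operator Q -> bounded_functional (fun f => Q f x).
Proof.
move=> bQ; split=> [a f h cf ch|]; first by rewrite (bo_linear bQ).
by have [M M0 QM] := bo_bounded bQ; exists M => // f cf; exact: QM.
Qed.

Lemma bo_coord Q j : bounded_operator Q ->
  bounded_functional (fun f => dot (Q f) (e j)).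
Proof.
move=> bQ; split=> [a f h cf ch|].
  rewrite (bo_linear bQ) // dotL2_linear //; apply: fspan_ccont;
    exact: bo_range.
have [M M0 QM] := bo_bounded bQ; have [N eN] := ccont_bounded cK (ce j).
exists (M * N) => [|f cf].
  by rewrite mulr_ge0// (le_trans _ (eN point))// normc_ge0.
have cQ := fspan_ccont (bo_range bQ cf).
apply: (normc_cint_le mu cK (ccont_mulJ cQ (ce j))) => x.
rewrite normcM normcJ mulrAC ler_pM ?normc_ge0//; exact: QM.
Qed.

Lemma oproj_bounded : bounded_operator oproj.
Proof.
split=> [f _|a f h cf ch|]; first exact: oproj_fspan.
  apply/funext => x; rewrite /oproj mulr_sumr -big_split.
  by apply: eq_bigr => j _ /=; rewrite dotL2_linear // mulrDl mulrA.
have [N eN] := choice (fun j => ccont_bounded cK (ce j)).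
have N0 j : 0 <= N j by rewrite (le_trans _ (eN j point))// normc_ge0.
exists (\sum_j N j * N j) => [|f x cf]; first by apply: sumr_ge0 => j _;
  exact: mulr_ge0.
rewrite /oproj mulr_suml; elim/big_ind2: _ => [|a b c d ab cd|j _].
- by rewrite normc0.
- by rewrite (le_trans (le_normcD _ _))// lerD.
rewrite normcM mulrAC ler_pM ?normc_ge0//.
apply: (normc_cint_le mu cK (ccont_mulJ cf (ce j))) => y.
rewrite normcM normcJ mulrC ler_pM ?normc_ge0//; exact: le_supnorm.
Qed.

Lemma bo_sub Q T : bounded_operator Q -> bounded_operator T ->
  bounded_operator (fun f x => Q f x - T f x).
Proof.
move=> bQ bT; split=> [f cf|a f h cf ch|].
- have [_ SP] := fspan_closed e.
  have := SP (-1) _ _ (bo_range bT cf) (bo_range bQ cf).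
  by under eq_fun do rewrite mulN1r addrC.
- apply/funext => x; rewrite (bo_linear bQ) // (bo_linear bT) //.
  by rewrite mulrBr opprD addrACA.
have [M M0 QM] := bo_bounded bQ; have [N N0 TN] := bo_bounded bT.
exists (M + N) => [|f x cf]; first exact: addr_ge0.
rewrite (le_trans (le_normcD _ _))// normcN mulrDl lerD//;
  [exact: QM|exact: TN].
Qed.

Lemma bo_kernel_cont Q Phi : bounded_operator Q -> kcont Phi ->
  kcont (fun z x => Q (fun y => Phi y x) z).
Proof.
move=> bQ cPhi.
rewrite (_ : (fun z x => _) = fun z x =>
    \sum_j dot (Q (fun y => Phi y x)) (e j) * e j z); last first.
  apply/funext => z; apply/funext => x.
  exact: fspan_expand (bo_range bQ (kcont_l x cPhi)).
apply: (@ccont_sum _ _ _ _ (fun j (p : K * K) =>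
  dot (Q (fun y => Phi y p.2)) (e j) * e j p.1)) => j.
apply: ccontM; last exact: kcont_fst.
exact: kcont_snd (bf_kernel_cont cK (bo_coord j bQ) cPhi).
Qed.

(* The integral is the trace of [Q] composed with the integral operator of *)
(* kernel [Phi], which maps [S] to [S] because it is equivariant.            *)
Lemma trace_eq0 Q Phi : bounded_operator Q ->
  (forall f, S f -> Q f = fun=> 0) ->
  kcont Phi -> kinv act Phi -> cint mu (fun x => Q (fun y => Phi y x) x) = 0.
Proof.
move=> bQ Q0 cPhi iPhi.
pose T f y := cint mu (fun x => Phi y x * f x).
have cPf f : ccont f -> kcont (fun y x => Phi y x * f x).
  by move=> cf; exact: ccontM cPhi (kcont_snd cf).
have ST f : S f -> S (T f).
  apply: S_stable => [a f1 f2 S1 S2|g f1 S1]; apply/funext => y; rewrite /T.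
    have [c1 c2] := (kcont_r y (cPf _ (fspan_ccont S1)), kcont_r y (cPf _
      (fspan_ccont S2))).
    rewrite -(cintZ mu cK a c1) -(cintD mu cK (ccontZ a c1) c2).
    by congr cint; apply/funext => x; rewrite mulrDr mulrCA.
  rewrite /translate; have c1 := kcont_r (act g^-1%g y) (cPf _ (fspan_ccont
    S1)).
  rewrite -(cint_act hK inv g^-1%g c1); congr cint; apply/funext => x.
  by rewrite iPhi.
pose nu j f := dot (Q f) (e j).
(* Expanding along the basis gives the coordinate functionals of [Q] at the kernels
   [Phi y x * e j x]; exchanging them with the integral produces [Q (T (e j))], which is 0 since
   [T (e j)] lies in [S]. *)
have -> : (fun x => Q (fun y => Phi y x) x) =
    fun x => \sum_j nu j (fun y => Phi y x * e j x).
  apply/funext => x; rewrite (fspan_expand x (bo_range bQ (kcont_l x cPhi))).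
  apply: eq_bigr => j _; under [in RHS]eq_fun do rewrite mulrC.
  by rewrite mulrC; exact: esym (bfZ (bo_coord j bQ) (e j x) (kcont_l x cPhi)).
have cj j := cPf _ (ce j).
rewrite (cint_sum mu cK _ (fun j => bf_kernel_cont cK (bo_coord j bQ) (cj j))).
apply: big1 => j _; rewrite -(functional_Fubini mu cK (bo_coord j bQ) (cj j)).
rewrite /nu -/(T (e j)) (Q0 _ (ST _ (fspan_mem e j))).
rewrite /dotL2 -/(cint _ _) -[RHS](cint_cst mu).
by congr cint; apply/funext => x; rewrite mul0r.
Qed.

(* For an invariant kernel [Phi] put [Psi z x := D (Phi (., x)) z]. The trace *)
(* of [D] against the kernel [\int Phi (y, x) (Psi z x)^* dx] is              *)
(* [\int \int |Psi|^2], hence [Psi = 0]; and the functions                    *)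
(* [\int Phi (., x) f x dx] approximate [f].                                  *)
Lemma equivariant_eq0 D : bounded_operator D ->
  (forall f, S f -> D f = fun=> 0) ->
  (forall g f, ccont f -> D (translate act g f) = translate act g (D f)) ->
  forall f, ccont f -> D f = fun=> 0.
Proof.
move=> bD D0 eD.
have kernel0 Phi x : kcont Phi -> kinv act Phi -> D (fun y => Phi y x) = fun=>
  0.
  move=> cPhi iPhi; pose Psi z x := D (fun y => Phi y x) z.
  have cPsi : kcont Psi by exact: bo_kernel_cont.
  have iPsi : kinv act Psi.
    move=> g z w; rewrite /Psi.
    have -> : (fun y => Phi y (act g w)) = translate act g (fun y => Phi y w).
      by apply/funext => y; rewrite /translate -{1}(actVK hK g y) iPhi.
    by rewrite eD ?/translate ?(actK hK) //; exact: kcont_l.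
  pose Phi' y z := cint mu (fun x => Phi y x * (Psi z x)^*).
  have cPP z : kcont (fun y x => Phi y x * (Psi z x)^*).
    by apply: ccontM => //; exact: kcont_snd (ccontJ (kcont_r z cPsi)).
  have cPhi' : kcont Phi'.
    apply: (ccont_cint mu cK (F := fun p x => Phi p.1 x * (Psi p.2 x)^*)).
    apply: ccontM.
      apply: (ccont_comp (u := fun q : K * K * K => (q.1.1, q.2)) _ cPhi) => q.
      apply: cvg_pair => /=; last exact: cvg_snd.
      exact: (cvg_comp _ _ cvg_fst cvg_fst).
    apply: ccontJ.
    apply: (ccont_comp (u := fun q : K * K * K => (q.1.2, q.2)) _ cPsi) => q.
    apply: cvg_pair => /=; last exact: cvg_snd.
    exact: (cvg_comp _ _ cvg_fst cvg_snd).
  have iPhi' : kinv act Phi'.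
    move=> g y z; rewrite /Phi'.
    have c1 := kcont_r y (cPP z).
    have c2 := kcont_r (act g y) (cPP (act g z)).
    rewrite -(cint_act hK inv g c2); congr cint; apply/funext => w.
    by rewrite iPhi iPsi.
  have DPhi' z : D (fun y => Phi' y z) z = cint mu (fun x => Psi z x * (Psi z
    x)^*).
    rewrite /Phi' (functional_Fubini mu cK (bo_eval z bD) (cPP z)).
    congr cint; apply/funext => w; under eq_fun do rewrite mulrC.
    exact: etrans (bfZ (bo_eval z bD) _ (kcont_l w cPhi)) (mulrC _ _).
  have := trace_eq0 bD D0 cPhi' iPhi'.
  rewrite (_ : (fun z => _) = fun z => (rint mu (fun x => normc (Psi z x) ^+
    2))%:C); last first.
    apply/funext => z; rewrite DPhi' -cint_real.
    by congr cint; apply/funext => w; rewrite mulJc_normc.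
  (* The integral of |Psi z x|^2 over x is continuous and nonnegative in [z] with integral 0, so it
     vanishes for every [z]; then so does each slice of [Psi]. *)
  rewrite cint_real => -[h0]; apply/funext => z.
  apply: (cint_normc_eq0 hK inv (kcont_r z cPsi)).
  under eq_fun do rewrite mulJc_normc; rewrite cint_real; congr (_%:C).
  apply/eqP; apply: contra_eqT h0 => hz; rewrite gt_eqF //.
  apply: (rint_gt0 hK inv (y := z)).
  - rewrite /rcont; under eq_fun do rewrite -cint_real.
    apply: (kcont_cint mu cK (Phi := fun z x => (normc (Psi z x) ^+ 2)%:C)).
    rewrite /kcont; under eq_fun do rewrite -mulJc_normc.
    exact: ccontM cPsi (ccontJ cPsi).
  - by move=> w; apply: rint_ge0 => v; exact: sqr_ge0.
  - by rewrite lt_neqAle eq_sym hz rint_ge0 // => v; exact: sqr_ge0.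
move=> f cf; apply/funext => z; apply/eqP;
  rewrite -normc_eq0 eq_le normc_ge0 andbT.
have [M M0 DM] := bo_bounded bD.
apply/ler_addgt0Pl => e' e'0; rewrite addr0.
have d0 : 0 < e' / (M + 1) by rewrite divr_gt0// ltr_wpDl.
(* [D] kills the average of [f] against [Phi], by [kernel0] and Fubini, and the remainder
   contributes at most [M * (e' / (M + 1))]. *)
have [Phi [cPhi iPhi Phif]] := invariant_approx cG hK inv cf d0.
have cPf : kcont (fun y x => Phi y x * f x) by exact: ccontM cPhi (kcont_snd
  cf).
have cF := kcont_cint mu cK cPf.
have DF : D (fun y => cint mu (fun x => Phi y x * f x)) z = 0.
  rewrite (functional_Fubini mu cK (bo_eval z bD) cPf) -[RHS](cint_cst mu).
  congr cint; apply/funext => w; under eq_fun do rewrite mulrC.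
  by rewrite (bfZ (bo_eval z bD) (f w) (kcont_l w cPhi)) kernel0 // mulr0.
rewrite -[D f z]subr0 -DF -(bfB (bo_eval z bD) cf cF).
rewrite (le_trans (DM _ _ (ccontB cf cF)))//.
apply: (@le_trans _ _ (M * (e' / (M + 1)))).
  by rewrite ler_wpM2l//; exact: supnorm_le.
by rewrite mulrCA ler_piMr ?(ltW e'0)// ler_pdivrMr ?mul1r ?lerDl// ltr_wpDl.
Qed.

End EquivariantProjections.

Lemma fun_linE {R : realType} {K : Type} (a : R[i]) (f h : K -> R[i]) :
  a *: f + h = fun x => a * f x + h x.
Proof. by apply/funext. Qed.

(** * Projections of C(K) onto [S]: uniqueness and lower bound *)

Section ProjectionBounds.
Context {R : realType} {G : topologicalGroupType} {K : ptopologicalType}.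
Context {act : G -> K -> K}.
Notation C := R[i].
Variable mu : probability (borel K) R.
Hypothesis cG : compact [set: G].
Hypothesis hK : homogeneous_space act.
Hypothesis inv : invariant_measure act mu.
Context {J : finType}.
Variable e : J -> K -> C.
Hypothesis ce : forall j, ccont (e j).
Hypothesis oe : forall i j, dotL2 mu (e i) (e j) = (i == j)%:R.
Notation S := (fspan e).
Hypothesis S_inv : forall g f, S f -> S (translate act g f).
Hypothesis S_stable : forall T : (K -> C) -> K -> C,
  (forall a f h, S f -> S h ->
    T (fun x => a * f x + h x) = fun x => a * T f x + T h x) ->
  (forall g f, S f -> T (translate act g f) = translate act g (T f)) ->
  forall f, S f -> S (T f).

Let cK : compact [set: K] := space_compact hK.

Lemma projection_bounded_operator Q : projection_onto S Q ->
  bounded_operator e Q.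
Proof.
move=> [Qr Ql [M QM] _]; split=> [f /ccontP cf|a f h /ccontP cf /ccontP ch|].
- exact: Qr.
- by rewrite -!fun_linE; exact: (Ql a f h cf ch).
exists `|M| => // f x cf.
have Cf : CK f by exact/ccontP.
have cQ := fspan_ccont ce (Qr f Cf).
apply: le_trans (le_supnorm cK x cQ) _.
apply: le_trans (QM f Cf) _.
by apply: ler_wpM2r; [exact: (supnorm_ge0 cK cf)|exact: ler_norm].
Qed.

(** The difference of [Q] and [oproj] is bounded, equivariant and zero on [S], so [equivariant_eq0]
    applies. *)
Lemma equivariant_projection_unique Q : projection_onto S Q ->
  equivariant act Q -> forall f, ccont f -> Q f = oproj mu e f.
Proof.
move=> pQ eQ f cf; have bQ := projection_bounded_operator pQ.
have bP := oproj_bounded mu hK ce; have bD := bo_sub bQ bP.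
have := equivariant_eq0 cG hK inv ce oe S_stable bD.
move=> /(_ _ _ _ cf) D0; apply/funext => x; apply/eqP; rewrite -subr_eq0;
  apply/eqP.
apply: (congr1 (fun f => f x) (D0 _ _)) => [h Sh|g h ch]; apply/funext => y.
  by rewrite (proj_id pQ Sh) (oproj_id hK ce oe Sh) subrr.
rewrite (oproj_translate hK inv ce oe S_inv g ch) eQ //.
exact/ccontP.
Qed.

Lemma oproj_orthogonal f : ccont f -> orthogonal_projection mu S f (oproj mu e
  f).
Proof.
move=> cf; split=> [|_ [c ->]]; first exact: oproj_fspan.
have cP := fspan_ccont ce (oproj_fspan mu e f).
have cS : ccont (fun x => \sum_j c j * e j x) by apply: ccont_sum => j;
  exact: ccontZ.
rewrite (dotL2B mu hK cf cP cS); apply/eqP; rewrite subr_eq0; apply/eqP.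
rewrite !(dotL2_sumr mu hK ce) //; apply: eq_bigr => j _; congr (_ * _).
rewrite /oproj (dotL2_suml mu hK ce) // (bigD1 j) //= oe eqxx mulr1 big1 ?addr0
  // => i ij.
by rewrite oe (negPf ij) mulr0.
Qed.

Lemma rkernel_normcC x y : normc (rkernel e x y) = normc (rkernel e y x).
Proof. by rewrite -(rkernelC e) normcJ. Qed.

(** Hermitian symmetry exchanges the two variables of the kernel; its invariance and transitivity
    move the base point. *)
Lemma rint_rkernel x x' :
  rint mu (fun y => normc (rkernel e y x)) =
  rint mu (fun y => normc (rkernel e x' y)).
Proof.
have [g gx] := act_transitive hK x' x.
rewrite -gx (_ : (fun y => normc (rkernel e y _)) =
    fun y => normc (rkernel e (act g x') y)); last first.
  by apply/funext => y; exact: rkernel_normcC.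
have ck : rcont (fun y => normc (rkernel e (act g x') y)).
  by apply: rcont_normc; apply: kcont_r; exact: rkernel_cont.
rewrite -(rint_act hK inv g ck); congr rint; apply/funext => y.
by rewrite (rkernel_inv hK inv ce oe S_inv).
Qed.

(* The trace of [P - oproj] vanishes against the regularized sign             *)
(* [(k y x)^* / (|k y x| + t)] of the kernel; the trace of [P] is at most [M] *)
(* and that of [oproj] is [\int |k|^2 / (|k| + t)].                           *)
Lemma projection_lower_bound P (M : R) x0 : bounded_operator e P ->
  (forall f, S f -> P f = f) -> 0 <= M ->
  (forall f x, ccont f -> normc (P f x) <= M * supnorm f) ->
  rint mu (fun y => normc (rkernel e x0 y)) <= M.
Proof.
move=> bP P_id M0 PM; apply/ler_addgt0Pr => t t0; rewrite -lerBlDr.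
set c := rint _ _; pose k := rkernel e.
have ck : kcont k by exact: rkernel_cont.
pose w y x : R := (normc (k y x) + t)^-1.
have w0 y x : 0 < normc (k y x) + t by rewrite ltr_wpDl// normc_ge0.
pose Phi y x := (w y x)%:C * (k y x)^*.
have cw : kcont (fun y x => (w y x)%:C).
  apply: (rcontV (h := fun p : K * K => normc (k p.1 p.2) + t)) => [|p].
    by apply: rcontD; [exact: rcont_normc ck|exact: ccont_cst].
  by rewrite gt_eqF.
have cPhi : kcont Phi by exact: ccontM cw (ccontJ ck).
have ki : kinv act k := rkernel_inv hK inv ce oe S_inv.
have iPhi : kinv act Phi by move=> g y x; rewrite /Phi /w !ki.
have bO := oproj_bounded mu hK ce.
have := trace_eq0 hK inv ce oe S_stable (bo_sub bP bO) _ cPhi iPhi.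
rewrite (cintB mu cK); last 2 first.
- have cP := bo_kernel_cont hK ce oe bP cPhi.
  apply: (ccont_comp (u := fun x => (x, x)) _ cP) => x.
  by apply: cvg_pair => /=; exact: cvg_id.
- have cO := bo_kernel_cont hK ce oe bO cPhi.
  apply: (ccont_comp (u := fun x => (x, x)) _ cO) => x.
  by apply: cvg_pair => /=; exact: cvg_id.
move=> H; have /H/eqP : forall f, S f ->
    (fun x => P f x - oproj mu e f x) = fun=> 0.
  move=> f Sf; apply/funext => x; rewrite P_id //.
  by rewrite (oproj_id hK ce oe Sf) subrr.
rewrite subr_eq0 => /eqP {}H.
have supPhi x : supnorm (fun y => Phi y x) <= 1.
  apply: supnorm_le => y; rewrite normcM normc_real normcJ.
  rewrite ger0_norm ?invr_ge0 ?(ltW (w0 _ _))// mulrC ler_pdivrMr ?w0// mul1r.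
  by rewrite lerDl ltW.
have : normc (cint mu (fun x => P (fun y => Phi y x) x)) <= M.
  apply: normc_cint_le => // [|x].
    have cP := bo_kernel_cont hK ce oe bP cPhi.
    apply: (ccont_comp (u := fun x => (x, x)) _ cP) => x.
    by apply: cvg_pair => /=; exact: cvg_id.
  apply: le_trans (PM _ x (kcont_l x cPhi)) _.
  by rewrite -[leRHS]mulr1 ler_wpM2l.
apply: le_trans; rewrite H.
pose q y x : R := w y x * normc (k y x) ^+ 2.
have cq x : rcont (fun y => q y x).
  apply: rcontM; first exact: kcont_l x cw.
  have cn : rcont (fun y => normc (k y x)) by apply: rcont_normc;
    exact: kcont_l.
  by under eq_fun do rewrite expr2; exact: rcontM.
have OE x : oproj mu e (fun y => Phi y x) x = (rint mu (fun y => q y x))%:C.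
  rewrite (oprojE mu hK ce _ (kcont_l x cPhi)) -cint_real; congr cint.
  apply/funext => y; rewrite /Phi /q rmorphM /= -mulrA; congr (_ * _).
  by rewrite mulrC mulJc_normc.
have qc x : c - t <= rint mu (fun y => q y x).
  have cn : rcont (fun y => normc (k y x)) by apply: rcont_normc;
    exact: kcont_l.
  have -> : c - t = rint mu (fun y => normc (k y x) + - t).
    rewrite (rintD mu cK cn) ?rint_cst ?(rint_rkernel x x0)//; exact: ccont_cst.
  apply: (rint_le mu cK) => // [|y]; first by apply: rcontD => //;
    exact: ccont_cst.
  (* With a = |k|, the bound a - t <= a^2 / (a + t) is (a - t)(a + t) <= a^2. *)
  rewrite /q /w mulrC ler_pdivlMr // -subr_sqr lerBlDr lerDl; exact: sqr_ge0.
under eq_fun do rewrite OE.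
rewrite cint_real normc_real (le_trans _ (ler_norm _))//.
rewrite -[leLHS](rint_cst mu); apply: (rint_le mu cK) => //;
  first exact: ccont_cst.
rewrite /rcont; under eq_fun do rewrite -OE.
have cO := bo_kernel_cont hK ce oe bO cPhi.
apply: (ccont_comp (u := fun x => (x, x)) _ cO) => x.
by apply: cvg_pair => /=; exact: cvg_id.
Qed.

(** In the basis [d], the coordinates of [rkernel e y] are the conjugates of [d j y], by the
    reproducing property. *)
Lemma onb_kernel_unique n (d : 'I_n -> K -> C) : orthonormal_basisL2 mu S d ->
  forall y x, reproducing_kernel d y x = rkernel e y x.
Proof.
move=> [od Sd] y x; have Sdd i : S (d i).
  rewrite Sd; exists (fun j => (j == i)%:R); rewrite (bigD1 i) //= eqxx scale1r.
  by rewrite big1 ?addr0 // => j /negPf ->; rewrite scale0r.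
have cd i := fspan_ccont ce (Sdd i).
have od' i j : dotL2 mu (d i) (d j) = (i == j)%:R by exact: od.
have Sd' : fspan d = S.
  by rewrite Sd; apply/seteqP; split=> _ [c ->]; exists c; rewrite fun_sumE.
have Sk : fspan d (rkernel e y) by rewrite Sd'; exact: rkernel_fspan.
rewrite (fspan_expand hK cd od' x Sk); apply: eq_bigr => j _; congr (_ * _).
have ck := kcont_r y (rkernel_cont ce).
rewrite -[d j y](rkernel_reproducing hK ce oe y (Sdd j)).
rewrite /dotL2 -!/(cint _ _) -(cintJ mu cK (ccont_mulJ (cd j) ck)).
congr cint; apply/funext => z; by rewrite conjcM conjcKK mulrC.
Qed.

End ProjectionBounds.

(** * The lower bound *)

Section BoundedFunctions.
Variables (R : realType) (K : ptopologicalType).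
Notation C := R[i].

Definition bounded_pred : {pred K -> C} :=
  fun f => `[< exists M : R, forall x, normc (f x) <= M >].

Lemma bounded_predP (f : K -> C) :
  reflect (exists M : R, forall x, normc (f x) <= M) (f \in bounded_pred).
Proof. exact: asboolP. Qed.

Lemma bounded_submod : GRing.submod_closed bounded_pred.
Proof.
split; first by apply/bounded_predP; exists 0 => x; rewrite normc0.
move=> a f g /bounded_predP[M fM] /bounded_predP[N gN]; apply/bounded_predP.
exists (normc a * M + N) => x; rewrite (le_trans (le_normcD _ _))// lerD//.
by rewrite normcM ler_wpM2l// normc_ge0.
Qed.

HB.instance Definition _ :=
  GRing.isSubmodClosed.Build C (K -> C) bounded_pred bounded_submod.

(** The ambient Banach space for the lower bound: all bounded functions, so that completeness
    follows from pointwise limits without a continuity argument. *)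
Record linf := Linf { linf_val :> K -> C;
  linf_valP : linf_val \in bounded_pred }.

HB.instance Definition _ := [isSub for linf_val].
HB.instance Definition _ := [Choice of linf by <:].
HB.instance Definition _ := [SubChoice_isSubLmodule of linf by <:].

Lemma linf_le_supnorm (f : linf) x : normc (f x) <= supnorm f.
Proof.
have /bounded_predP[M fM] := linf_valP f.
apply: ub_le_sup; last by exists x.
by exists M => _ [y _ <-].
Qed.

Lemma linf_supnorm_ge0 (f : linf) : 0 <= supnorm f.
Proof. by apply: le_trans (linf_le_supnorm f point); exact: normc_ge0. Qed.

Lemma linf_normD (f g : linf) :
  (supnorm (f + g : linf))%:C <= (supnorm f)%:C + (supnorm g)%:C :> C.
Proof.
rewrite -rmorphD lecR; apply: supnorm_le => x.
rewrite (le_trans (le_normcD _ _))// lerD//; exact: linf_le_supnorm.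
Qed.

Lemma linf_normZ (a : C) (f : linf) :
  (supnorm (a *: f : linf))%:C = `|a| * (supnorm f)%:C :> C.
Proof.
rewrite normcE -rmorphM /=; congr (_%:C); apply/eqP; rewrite eq_le; apply/andP;
  split.
  apply: supnorm_le => x; rewrite normcM ler_wpM2l ?normc_ge0//.
  exact: linf_le_supnorm.
have [->|a0] := eqVneq a 0; first by rewrite normc0 mul0r;
  exact: (linf_supnorm_ge0 (0 *: f)).
have na : 0 < normc a by rewrite lt_neqAle eq_sym normc_eq0 a0 normc_ge0.
rewrite mulrC -ler_pdivlMr//; apply: supnorm_le => x.
rewrite ler_pdivlMr// mulrC -normcM.
exact: (linf_le_supnorm (a *: f) x).
Qed.

Lemma linf_norm_eq0 (f : linf) : (supnorm f)%:C = 0 :> C -> f = 0.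
Proof.
move=> [f0]; apply/val_inj/funext => x; apply/eqP.
rewrite -normc_eq0 eq_le normc_ge0 andbT -f0; exact: linf_le_supnorm.
Qed.

HB.instance Definition _ := Lmodule_isNormed.Build C linf
  linf_normD linf_normZ linf_norm_eq0.

Lemma linf_normE (f : linf) : `|f| = (supnorm f)%:C :> C.
Proof. by []. Qed.

Lemma normc_le_ReIm (z : C) : normc z <= `|complex.Re z| + `|complex.Im z|.
Proof.
rewrite {1}(complexE z) (le_trans (le_normcD _ _))// normcM !normc_real.
by rewrite /= expr0n /= add0r expr1n sqrtr1 mul1r.
Qed.

Lemma linf_complete (F : set_system linf) : ProperFilter F -> cauchy F -> cvg F.
Proof.
move=> FF /cauchyP cF.
have cFe (d : R) : 0 < d -> exists f : linf, F [set g | forall x, normc (f x -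
  g x) < d].
  move=> d0; have [|f Ff] := cF d%:C; first by rewrite ltcR.
  exists f; apply: filterS Ff => g;
    rewrite -ball_normE /= linf_normE ltcR => fg x.
  exact: le_lt_trans (linf_le_supnorm (f - g) x) fg.
have lim_part (p : C -> R) : (forall z w, `|p z - p w| <= normc (z - w)) ->
    exists l : K -> R, forall x, (fun g : linf => p (g x)) @ F --> l x.
  move=> p_lip; suff H x : exists l : R, (fun g : linf => p (g x)) @ F --> l.
    by have [l Hl] := choice H; exists l.
  apply/cvg_ex; apply: R_complete; apply/cauchyP => d d0.
  have [f Ff] := cFe d d0; exists (p (f x)).
  suff: F [set g : linf | ball (p (f x)) d (p (g x))] by [].
  apply: filterS Ff => g fg /=.
  by rewrite -ball_normE /=; exact: le_lt_trans (p_lip _ _) (fg x).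
have Re_lip (z w : C) : `|complex.Re z - complex.Re w| <= normc (z - w).
  have -> : complex.Re z - complex.Re w = complex.Re (z - w).
    by case: (z); case: (w).
  by have := normc_ge_Re (z - w); rewrite lecR.
have Im_lip (z w : C) : `|complex.Im z - complex.Im w| <= normc (z - w).
  rewrite !ImE; apply: le_trans (Re_lip _ _) _.
  rewrite -mulrBl normcM (_ : normc (- 'i%C) = 1) ?mulr1 //.
  by rewrite normcN /= expr0n /= add0r expr1n sqrtr1.
have [l1 Hl1] := lim_part _ Re_lip; have [l2 Hl2] := lim_part _ Im_lip.
pose l x : C := l1 x +i* l2 x.
(* Real and imaginary parts cost [d] each and passing from [g] to [f] another [d]; 4 is a convenient
   upper bound for 3. *)
have lf (d : R) (f : linf) : 0 < d -> F [set g | forall x, normc (f x - g x) <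
  d] ->
    forall x, normc (l x - f x) <= 4 * d.
  move=> d0 Ff x.
  have F1 : F [set g : linf | `|l1 x - complex.Re (g x)| < d].
    by move/cvgrPdist_lt : (Hl1 x) => /(_ d d0).
  have F2 : F [set g : linf | `|l2 x - complex.Im (g x)| < d].
    by move/cvgrPdist_lt : (Hl2 x) => /(_ d d0).
  have [g [/= [fg g1] g2]] := filter_ex (filterI (filterI Ff F1) F2).
  have lg : normc (l x - g x) <= 2 * d.
    apply: le_trans (normc_le_ReIm _) _; rewrite mulr_natl mulr2n lerD ?ltW//.
      by move: g1; rewrite /l; case: (g x).
    by move: g2; rewrite /l; case: (g x).
  apply: le_trans (normcD3 _ (g x) _) _.
  apply: (@le_trans _ _ (2 * d + d));
    last by rewrite (_ : 4 = 2 + 1 + 1) ?mulrDl ?mul1r ?lerDl ?ltW//; ring.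
  by rewrite lerD// normcB ltW.
have lb : l \in bounded_pred.
  have [f Ff] := cFe 1 ltr01; have /bounded_predP[M fM] := linf_valP f.
  apply/bounded_predP; exists (4 * 1 + M) => x.
  rewrite -[l x](subrK (f x)) (le_trans (le_normcD _ _))// lerD//.
  exact: (lf 1 f ltr01 Ff x).
apply/cvg_ex; exists (Linf lb); apply/cvgrPdist_lt => -[d i].
rewrite ltcE /= => /andP[/eqP -> d0].
(* The total error is [4 * (d / 6) + d / 6], strictly below [d]. *)
have d60 : 0 < d / 6 by rewrite divr_gt0.
have [f Ff] := cFe _ d60; apply: (filterS _ Ff) => g fg.
rewrite linf_normE -[_ +i* 0]/(d%:C) ltcR.
apply: (@le_lt_trans _ _ (4 * (d / 6) + d / 6)).
  apply: supnorm_le => x; apply: le_trans (normcD3 _ (f x) _) _.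
  by apply: lerD; [exact: (lf _ f d60 Ff x)|exact: ltW (fg x)].
have -> : 4 * (d / 6) + d / 6 = 5 / 6 * d by field.
by rewrite gtr_pMl// ltr_pdivrMr// mul1r ltr_nat.
Qed.

HB.instance Definition _ := Uniform_isComplete.Build linf linf_complete.

(** Unbounded functions are sent to 0; the embedding is only used on continuous functions. *)
Definition to_linf (f : K -> C) : linf := insubd (0 : linf) f.

Lemma to_linfE (f : K -> C) : f \in bounded_pred -> to_linf f = f :> (K -> C).
Proof. by move=> bf; rewrite /to_linf insubdK. Qed.

End BoundedFunctions.

Section LowerBound.
Context {R : realType} {G : topologicalGroupType} {K : ptopologicalType}.
Context {act : G -> K -> K}.
Notation C := R[i].
Variable mu : probability (borel K) R.
Hypothesis hK : homogeneous_space act.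
Hypothesis inv : invariant_measure act mu.
Context {J : finType}.
Variable e : J -> K -> C.
Hypothesis ce : forall j, ccont (e j).
Hypothesis oe : forall i j, dotL2 mu (e i) (e j) = (i == j)%:R.
Notation S := (fspan e).
Hypothesis S_inv : forall g f, S f -> S (translate act g f).
Hypothesis S_stable : forall T : (K -> C) -> K -> C,
  (forall a f h, S f -> S h ->
    T (fun x => a * f x + h x) = fun x => a * T f x + T h x) ->
  (forall g f, S f -> T (translate act g f) = translate act g (T f)) ->
  forall f, S f -> S (T f).

Let cK : compact [set: K] := space_compact hK.

Lemma ccont_bounded_pred (f : K -> C) : ccont f -> f \in @bounded_pred R K.
Proof. by move=> cf; apply/bounded_predP; exact: ccont_bounded. Qed.

Lemma to_linf_linear (a : C) (f h : K -> C) : ccont f -> ccont h ->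
  to_linf (a *: f + h) = a *: to_linf f + to_linf h.
Proof.
move=> cf ch; apply/val_inj => /=.
rewrite /to_linf !insubdK ?ccont_bounded_pred // fun_linE.
exact: ccontD (ccontZ a cf) ch.
Qed.

Lemma to_linf_norm (f : K -> C) : ccont f -> `|to_linf f| = (supnorm f)%:C.
Proof. by move=> cf; rewrite linf_normE to_linfE // ccont_bounded_pred. Qed.

Lemma opnorm_bound (P : {linear linf R K -> linf R K}) (M : R) (y : linf R K) :
  opnorm P = M%:E -> supnorm (P y) <= M * supnorm y.
Proof.
move=> PM; have [y0|y0] := eqVneq (supnorm y) 0.
  have -> : y = 0 by apply: linf_norm_eq0; rewrite y0.
  rewrite linear0 (_ : supnorm _ = 0) ?mulr0 //.
  apply/eqP; rewrite eq_le (linf_supnorm_ge0 (0 : linf R K)) andbT.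
  by apply: supnorm_le => x; rewrite normc0.
have y1 : 0 < supnorm y by rewrite lt_neqAle eq_sym y0 linf_supnorm_ge0.
have : ((complex.Re `|P ((supnorm y)^-1%:C *: y)|)%:E <= opnorm P)%E.
  apply: ereal_sup_ubound; exists ((supnorm y)^-1%:C *: y) => //=.
  rewrite linf_normE linf_normZ normcE normc_real ger0_norm ?invr_ge0 ?(ltW
    y1)//.
  by rewrite -rmorphM mulVf.
rewrite PM lee_fin linearZ linf_normE linf_normZ normcE normc_real.
rewrite ger0_norm ?invr_ge0 ?(ltW y1)// -rmorphM /= mulrC.
by rewrite ler_pdivrMr.
Qed.

(** A projection of [linf] onto [S], restricted to C(K), is a bounded projection onto [S] of no
    larger norm, so [projection_lower_bound] applies. *)
Lemma relative_projection_lower x0 :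
  ((rint mu (fun y => normc (rkernel e x0 y)))%:E <=
   relative_projection_constant (@to_linf R K @` S))%E.
Proof.
apply: le_ereal_inf_tmp => _ [P [_ PP rP] <-].
case PM : (opnorm P) => [M| |]; last 2 first.
- exact: leey.
- have : (0 <= opnorm P)%E.
    rewrite (le_trans _ (ereal_sup_ubound (_ : _ (complex.Re `|P 0|)%:E)))//.
      by rewrite lee_fin linear0 normr0.
    by exists 0 => //=; rewrite normr0.
  by rewrite PM.
rewrite lee_fin; pose Q f : K -> C := P (to_linf f).
have vS f : ccont f -> to_linf f = f :> (K -> C).
  by move=> cf; rewrite to_linfE // ccont_bounded_pred.
have QM f x : ccont f -> normc (Q f x) <= M * supnorm f.
  move=> cf; apply: le_trans (linf_le_supnorm (P (to_linf f)) x) _.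
  by have := opnorm_bound (to_linf f) PM; rewrite vS.
(* Tested on the constant function 1, a negative [M] would bound a modulus by a negative number. *)
have M0 : 0 <= M.
  have := QM (fun=> 1) x0 (ccont_cst 1); apply: contraTT; rewrite -!ltNge => M0.
  apply: lt_le_trans (normc_ge0 _); rewrite nmulr_rlt0//.
  apply: lt_le_trans (le_supnorm cK x0 (ccont_cst 1)); by rewrite normc1.
have P_id f : S f -> P (to_linf f) = to_linf f.
  move=> Sf; have : (@to_linf R K @` S) (to_linf f) by exists f.
  by rewrite -rP => -[y _ <-]; exact: PP.
apply: (projection_lower_bound hK inv ce oe S_inv S_stable (P := Q)) => //.
- split=> [f cf|a f h cf ch|]; last by exists M.
    have : range P (P (to_linf f)) by exists (to_linf f).
    rewrite rP => -[s Ss sE]; rewrite /Q -sE vS //; exact: fspan_ccont Ss.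
  by rewrite /Q -!fun_linE to_linf_linear // linearP.
- by move=> f Sf; rewrite /Q P_id // vS //; exact: fspan_ccont Sf.
Qed.

Lemma projection_constant_lower x0 :
  ((rint mu (fun y => normc (rkernel e x0 y)))%:E <=
   projection_constant supnorm S)%E.
Proof.
apply: le_trans (relative_projection_lower x0) _; apply: ereal_sup_ubound.
exists (linf R K), (@to_linf R K); split=> // [a f h Sf Sh|f Sf].
  by apply: to_linf_linear; apply: fspan_ccont.
by apply: to_linf_norm; exact: fspan_ccont Sf.
Qed.

End LowerBound.

(** * The upper bound *)

Section Sublinear.
Context {R : realType} {V : lmodType R[i]}.
Implicit Types (p q : V -> R) (v w : V).

Record sublinear p : Prop := Sublinear {
  sublinD : forall v w, p (v + w) <= p v + p w ;
  sublinZ : forall (c : R) v, 0 < c -> p (c%:C *: v) <= c * p v }.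

Lemma sublin0 p : sublinear p -> p 0 = 0.
Proof.
move=> [pD pZ]; apply/eqP; rewrite eq_le; apply/andP; split.
  have := pZ 2^-1 0; rewrite scaler0 invr_gt0 ltr0n => /(_ isT); lra.
have := pD 0 0; rewrite addr0; lra.
Qed.

Lemma sublinN p v : sublinear p -> - p (- v) <= p v.
Proof.
by move=> sp; have := sublinD sp v (- v); rewrite subrr (sublin0 sp); lra.
Qed.

Lemma has_inf_lb (A : set R) (m : R) : A !=set0 -> (forall a, A a -> m <= a) ->
  has_inf A.
Proof. by move=> A0 Am; split=> //; exists m => a; exact: Am. Qed.

(** The pointwise infimum of a downward directed family is sublinear; it is finite because every
    member is at least [- q (- v)]. It bounds chains from below in [Hahn_Banach]. *)
Lemma sublinear_inf (P : set (V -> R)) q p0 : P p0 ->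
  (forall p, P p -> sublinear p /\ forall v, p v <= q v) ->
  (forall p1 p2, P p1 -> P p2 -> exists2 p, P p &
     forall v, p v <= p1 v /\ p v <= p2 v) ->
  exists2 p, sublinear p & forall p', P p' -> forall v, p v <= p' v.
Proof.
move=> Pp0 Psub Pdir; pose A v := [set p v | p in P].
have hA v : has_inf (A v).
  apply: (@has_inf_lb _ (- q (- v))); first by exists (p0 v), p0.
  move=> _ [p Pp <-]; have [sp pq] := Psub p Pp.
  by apply: le_trans (sublinN v sp); rewrite lerN2.
have Ale v p : P p -> inf (A v) <= p v.
  by move=> Pp; apply: ge_inf; [exact: (hA v).2|exists p].
exists (fun v => inf (A v)) => [|p' Pp' v]; last exact: Ale.
split=> [v w|c v c0]; apply/ler_addgt0Pr => t t0.
  have t20 : 0 < t / 2 by rewrite divr_gt0.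
  have [_ [p1 P1 <-] p1v] := inf_adherent t20 (hA v).
  have [_ [p2 P2 <-] p2w] := inf_adherent t20 (hA w).
  have [p Pp pp] := Pdir _ _ P1 P2.
  have [pv _] := pp v; have [_ pw] := pp w.
  have := Ale (v + w) p Pp; have := sublinD (Psub p Pp).1 v w.
  by move: p1v p2w; rewrite -/(A v) -/(A w); lra.
have tc0 : 0 < t / c by rewrite divr_gt0.
have [_ [p Pp <-] pv] := inf_adherent tc0 (hA v).
apply: le_trans (Ale (c%:C *: v) p Pp) _.
apply: le_trans (sublinZ (Psub p Pp).1 v c0) _.
have -> : c * inf (A v) + t = c * (inf (A v) + t / c).
  by field; rewrite gt_eqF.
by rewrite ler_pM2l// ltW.
Qed.

(* [p] is compared with [v |-> inf_(t >= 0) (p (v + t z) - t p z)]. *)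
Lemma sublinear_minimal p : sublinear p ->
  (forall p', sublinear p' -> (forall v, p' v <= p v) -> p' = p) ->
  forall v z, p (v + z) = p v + p z.
Proof.
move=> sp pmin v z; apply/eqP; rewrite eq_le sublinD //=.
pose A v := [set p (v + t%:C *: z) - t * p z | t in [set t : R | 0 <= t]].
have tz (t : R) : 0 <= t -> p (t%:C *: z) <= t * p z.
  rewrite le_eqVlt => /predU1P[<-|t0]; last exact: sublinZ.
  by rewrite scale0r mul0r sublin0.
have tz' (t : R) : 0 <= t -> t * p z <= p (t%:C *: z).
  rewrite le_eqVlt => /predU1P[<-|t0]; first by rewrite scale0r mul0r sublin0.
  have := sublinZ sp (t%:C *: z) (_ : 0 < t^-1); rewrite invr_gt0 => /(_ t0).
  by rewrite scalerA -rmorphM mulVf ?gt_eqF// scale1r mulrC ler_pdivlMr //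
    mulrC.
have hA w : has_inf (A w).
  apply: (@has_inf_lb _ (- p (- w))).
    by exists (p (w + 0%:C *: z) - 0 * p z), 0 => /=.
  move=> _ [t /= t0 <-].
  have := sublinD sp (w + t%:C *: z) (- w); rewrite addrAC subrr add0r.
  by have := tz' t t0; lra.
have Ale w (t : R) : 0 <= t -> inf (A w) <= p (w + t%:C *: z) - t * p z.
  by move=> t0; apply: ge_inf; [exact: (hA w).2|exists t].
have : (fun w => inf (A w)) = p.
  apply: pmin => [|w]; last first.
    by have := Ale w 0 (lexx _); rewrite scale0r addr0 mul0r subr0.
  split=> [w w'|c w c0]; apply/ler_addgt0Pr => t t0.
    have t20 : 0 < t / 2 by rewrite divr_gt0.
    have [_ [r /= r0 <-] rw] := inf_adherent t20 (hA w).
    have [_ [r' /= r0' <-] rw'] := inf_adherent t20 (hA w').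
    have := Ale (w + w') _ (addr_ge0 r0 r0').
    have := sublinD sp (w + r%:C *: z) (w' + r'%:C *: z).
    by rewrite addrACA -scalerDl -rmorphD /= mulrDl; lra.
  have tc0 : 0 < t / c by rewrite divr_gt0.
  have [_ [r /= r0 <-] rw] := inf_adherent tc0 (hA w).
  have := Ale (c%:C *: w) _ (mulr_ge0 (ltW c0) r0).
  have := sublinZ sp (w + r%:C *: z) c0; rewrite scalerDr scalerA -rmorphM /=.
  have : c * (p (w + r%:C *: z) - r * p z) <= c * (inf (A w) + t / c).
    by rewrite ler_pM2l// ltW.
  rewrite mulrBr mulrDr mulrA (_ : c * (t / c) = t); first lra.
  by field; rewrite gt_eqF.
(* Minimality makes the infimum equal to [p]; its candidate [t = 1] then gives
   [p v <= p (v + z) - p z]. *)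
move=> /(congr1 (fun f => f v)) pv.
by have := Ale v 1 ler01; rewrite pv scale1r mul1r; lra.
Qed.

(** A minimal sublinear functional below [q], obtained from Zorn's lemma, is additive by
    [sublinear_minimal], hence real-linear. *)
Lemma Hahn_Banach q : sublinear q -> exists L : V -> R,
  [/\ forall v w, L (v + w) = L v + L w,
      forall (c : R) v, L (c%:C *: v) = c * L v &
      forall v, L v <= q v].
Proof.
move=> sq; pose T := {p : V -> R | sublinear p /\ forall v, p v <= q v}.
(* The order is reversed, so that a maximal element is a minimal functional. *)
pose le (s t : T) := `[< forall v, sval t v <= sval s v >].
have [||||[p [sp pq]] pmin] := @Zorn T le.
- by move=> s; apply/asboolP => v.
- move=> s t r /asboolP st /asboolP tr; apply/asboolP => v.
  exact: le_trans (tr v) (st v).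
- move=> [s Hs] [t Ht] /asboolP st /asboolP ts; apply: eq_exist => /=.
  by apply/funext => v; apply: le_anti; rewrite (ts v) (st v).
- move=> A Atot; have [[s0 As0]|A0] := pselect (exists s, A s); last first.
    exists (exist _ q (conj sq (fun v => lexx (q v)))) => s As.
    by exfalso; apply: A0; exists s.
  have [||_ _ [s1 H1 <-] [s2 H2 <-]|p sp pA] :=
      @sublinear_inf (@sval _ _ @` A) q (sval s0).
  + by exists s0.
  + by move=> _ [s Hs <-]; exact: svalP s.
  + case: (Atot _ _ H1 H2) => /asboolP le12.
      by exists (sval s2); [exists s2|move=> v; split=> //; exact: le12].
    by exists (sval s1); [exists s1|move=> v; split=> //; exact: le12].
  have pq v : p v <= q v.
    by apply: le_trans (pA _ _ v) ((svalP s0).2 v); exists s0.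
  exists (exist _ p (conj sp pq)) => s As; apply/asboolP => v.
  by apply: pA; exists s.
have pD : forall v w, p (v + w) = p v + p w.
  apply: sublinear_minimal => // p' sp' p'p.
  have p'q v : p' v <= q v by exact: le_trans (p'p v) (pq v).
  pose s' : T := exist _ p' (conj sp' p'q).
  have /pmin/(congr1 sval) : le (exist _ p (conj sp pq)) s' by apply/asboolP.
  by [].
have pN v : p (- v) = - p v.
  by apply/eqP; rewrite -subr_eq0 opprK addrC -pD subrr sublin0.
have pZ (c : R) v : 0 < c -> p (c%:C *: v) = c * p v.
  move=> c0; apply: le_anti; rewrite sublinZ //=.
  rewrite -[c * p v]opprK -mulrN -pN lerNl -pN -scalerN; exact: sublinZ.
exists p; split=> // c v; have [c0|c0|->] := ltgtP c 0; last 2 first.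
- exact: pZ.
- by rewrite scale0r mul0r sublin0.
by rewrite -[c]opprK rmorphN scaleNr pN pZ ?oppr_gt0// !mulNr.
Qed.

End Sublinear.

(** * A projection of small norm in any Banach space containing [S] *)

Section UpperBound.
Context {R : realType} {G : topologicalGroupType} {K : ptopologicalType}.
Context {act : G -> K -> K}.
Notation C := R[i].
Variable mu : probability (borel K) R.
Hypothesis hK : homogeneous_space act.
Hypothesis inv : invariant_measure act mu.
Context {J : finType}.
Variable e : J -> K -> C.
Hypothesis ce : forall j, ccont (e j).
Hypothesis oe : forall i j, dotL2 mu (e i) (e j) = (i == j)%:R.
Notation S := (fspan e).
Hypothesis S_inv : forall g f, S f -> S (translate act g f).
Variable x0 : K.
Variables (Y : completeNormedModType C) (emb : (K -> C) -> Y).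
Hypothesis emb_linear : forall (a : C) f h, S f -> S h ->
  emb (a *: f + h) = a *: emb f + emb h.
Hypothesis emb_isometric : forall f, S f -> `|emb f| = (supnorm f)%:C.

Let cK : compact [set: K] := space_compact hK.
Let M : R := rint mu (fun y => normc (rkernel e x0 y)).

Definition rnorm (w : Y) : R := complex.Re `|w|.

Lemma rnormE w : `|w| = (rnorm w)%:C.
Proof.
by have := normr_ge0 w; rewrite /rnorm; case: `|w| => a b;
  rewrite lecE /= => /andP[/eqP -> _].
Qed.

Lemma rnorm_ge0 w : 0 <= rnorm w.
Proof. by have := normr_ge0 w; rewrite rnormE lecR. Qed.

Lemma rnormD v w : rnorm (v + w) <= rnorm v + rnorm w.
Proof. by have := ler_normD v w; rewrite !rnormE -rmorphD lecR. Qed.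

Lemma rnormZ (a : C) w : rnorm (a *: w) = normc a * rnorm w.
Proof. by have := normrZ a w; rewrite !rnormE normcE -rmorphM => -[]. Qed.

Lemma rnorm0 : rnorm 0 = 0.
Proof. by rewrite /rnorm normr0. Qed.

Lemma rnormN w : rnorm (- w) = rnorm w.
Proof. by rewrite /rnorm normrN. Qed.

Lemma rnorm_sum I (r : seq I) (F : I -> Y) :
  rnorm (\sum_(i <- r) F i) <= \sum_(i <- r) rnorm (F i).
Proof.
elim: r => [|i r IHr]; first by rewrite !big_nil rnorm0.
by rewrite !big_cons (le_trans (rnormD _ _))// lerD.
Qed.

Let S0 : S (fun=> 0) := (fspan_closed e).1.

Let SP (a : C) f h : S f -> S h -> S (a *: f + h).
Proof. by move=> Sf Sh; rewrite fun_linE; exact: (fspan_closed e).2. Qed.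

Let SZ (a : C) f : S f -> S (a *: f).
Proof. by move=> Sf; rewrite -[a *: f]addr0; exact: SP. Qed.

Let SD f h : S f -> S h -> S (f + h).
Proof. by move=> Sf Sh; rewrite -[f]scale1r; exact: SP. Qed.

Lemma emb0 : emb 0 = 0.
Proof.
have := emb_linear (-1) S0 S0; rewrite !scaleN1r !addNr => <-.
by congr emb; rewrite addNr.
Qed.

Lemma embZ (a : C) f : S f -> emb (a *: f) = a *: emb f.
Proof. by move=> Sf; have := emb_linear a Sf S0; rewrite emb0 !addr0. Qed.

Lemma embD f h : S f -> S h -> emb (f + h) = emb f + emb h.
Proof. by move=> Sf Sh; have := emb_linear 1 Sf Sh; rewrite !scale1r. Qed.

Lemma emb_sum (c : J -> C) (F : J -> K -> C) : (forall j, S (F j)) ->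
  S (\sum_j c j *: F j) /\ emb (\sum_j c j *: F j) = \sum_j c j *: emb (F j).
Proof.
move=> SF; elim: (index_enum J) => [|j r [IH1 IH2]].
  by rewrite !big_nil emb0.
rewrite !big_cons; split; first exact: SP.
by rewrite emb_linear // IH2.
Qed.

Lemma rnorm_emb f : S f -> rnorm (emb f) = supnorm f.
Proof. by move=> Sf; rewrite /rnorm emb_isometric. Qed.

Implicit Types (v w : J -> Y) (h : K -> R).

(** A family [v] encodes a [Y]-valued function of [y]. The family [e j x *: w] encodes
    [rkernel e y x *: w], the integrand of the projection of [w] at [x]. *)
Definition at_point v y : Y := \sum_j (e j y)^* *: v j.

(* Any norm-one extension [phi] to [Y] of the evaluation [emb s |-> s y]  *)
(* satisfies [Re (phi (at_point v y)) <= h y].                                *)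
Definition dominates v h : Prop := rcont h /\
  forall y, exists2 s, S s & complex.Re (s y) + rnorm (at_point v y - emb s) <=
    h y.

Definition majorant v y : R := \sum_j normc (e j y) * rnorm (v j).

Lemma majorant_cont v : rcont (majorant v).
Proof.
rewrite /rcont /majorant; under eq_fun do rewrite rmorph_sum /=.
apply: ccont_sum => j; apply: (rcontM (rcont_normc (ce j))); exact: ccont_cst.
Qed.

Lemma at_point_le v y : rnorm (at_point v y) <= majorant v y.
Proof.
apply: le_trans (rnorm_sum _ _) _; apply: ler_sum => j _.
by rewrite rnormZ normcJ.
Qed.

Lemma dominates_majorant v : dominates v (majorant v).
Proof.
split=> [|y]; first exact: majorant_cont.
by exists (fun=> 0) => //=; rewrite emb0 subr0 add0r at_point_le.
Qed.

(** The modulus of [s y] is at most the norm of [emb s], so no choice of [s] pushes the sum below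
    minus the norm of [at_point v y]. This keeps [upper] finite. *)
Lemma dominates_ge v h y : dominates v h -> - majorant v y <= h y.
Proof.
move=> [_ /(_ y)[s Ss sh]]; apply: le_trans sh.
have cs := fspan_ccont ce Ss.
have : - complex.Re (s y) <= rnorm (emb s).
  rewrite (rnorm_emb Ss) (le_trans _ (le_supnorm cK y cs))// -(normcN (s y)).
  by apply: le_trans (Re_le_normc _); case: (s y).
have := rnormD (at_point v y) (emb s - at_point v y).
rewrite addrC subrK -[rnorm (emb s - _)]rnormN opprB.
by have := at_point_le v y; lra.
Qed.

(** An upper integral standing for the real part of int phi_y(at_point v y) dy, with no choice of
    the extensions phi_y. *)
Definition upper v : R := inf [set rint mu h | h in dominates v].

Lemma upper_has_inf v : has_inf [set rint mu h | h in dominates v].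
Proof.
apply: (@has_inf_lb _ _ (rint mu (fun y => - majorant v y))).
  by exists (rint mu (majorant v)), (majorant v) => //;
    exact: dominates_majorant.
move=> _ [h vh <-]; apply: (rint_le mu cK) => [||y]; last exact: dominates_ge.
- exact/rcontN/majorant_cont.
- exact: vh.1.
Qed.

Lemma upper_le v h : dominates v h -> upper v <= rint mu h.
Proof. by move=> vh; apply: ge_inf; [exact: (upper_has_inf v).2|exists h]. Qed.

Lemma at_pointD v w y : at_point (v + w) y = at_point v y + at_point w y.
Proof.
by rewrite /at_point -big_split; apply: eq_bigr => j _ /=; rewrite -scalerDr.
Qed.

Lemma at_pointZ (a : C) v y : at_point (a *: v) y = a *: at_point v y.
Proof.
rewrite /at_point scaler_sumr; apply: eq_bigr => j _.
by rewrite !scalerA mulrC.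
Qed.

Lemma upper_sublinear : sublinear (upper : (J -> Y) -> R).
Proof.
split=> [v w|c v c0]; apply/ler_addgt0Pr => t t0.
  have t20 : 0 < t / 2 by rewrite divr_gt0.
  have [_ [h vh <-] hv] := inf_adherent t20 (upper_has_inf v).
  have [_ [k wk <-] kw] := inf_adherent t20 (upper_has_inf w).
  have : upper (v + w) <= rint mu (fun y => h y + k y).
    apply: upper_le; split=> [|y]; first exact: rcontD vh.1 wk.1.
    have [s Ss sh] := vh.2 y; have [r Sr rk] := wk.2 y.
    exists (s + r); first exact: SD.
    rewrite at_pointD embD // opprD addrACA [complex.Re _]ReD.
    by have := rnormD (at_point v y - emb s) (at_point w y - emb r); lra.
  rewrite (rintD mu cK vh.1 wk.1).
  by move: hv kw; rewrite -/(upper v) -/(upper w); lra.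
have tc0 : 0 < t / c by rewrite divr_gt0.
have [_ [h vh <-] hv] := inf_adherent tc0 (upper_has_inf v).
have : upper (c%:C *: v) <= rint mu (fun y => c * h y).
  apply: upper_le; split=> [|y]; first exact: rcontZ vh.1.
  have [s Ss sh] := vh.2 y; exists (c%:C *: s); first exact: SZ.
  rewrite at_pointZ embZ // -scalerBr rnormZ normc_real gtr0_norm //.
  have -> : complex.Re ((c%:C *: s) y) = c * complex.Re (s y).
    by rewrite -[(c%:C *: s) y]/(c%:C * s y); case: (s y) => a b /=;
      rewrite mul0r subr0.
  by rewrite -mulrDr ler_pM2l.
move=> /le_trans; apply; rewrite (rintZ mu cK _ vh.1).
have -> : c * inf [set rint mu h | h in dominates v] + t =
    c * (inf [set rint mu h | h in dominates v] + t / c).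
  by field; rewrite gt_eqF.
by rewrite ler_pM2l// ltW.
Qed.

(* A real-linear [L <= upper] on [J -> Y] is the real part of a complex-linear *)
(* functional [LC]; on [v] with values in [emb @` S] it is an honest integral. *)
(* The coordinates of the projection are [LC] at the families supported at one *)
(* index.                                                                      *)
Lemma upper_projection : (relative_projection_constant (emb @` S) <= M%:E)%E.
Proof.
have [L [LD LZ Lu]] := Hahn_Banach upper_sublinear.
have L0 : L 0 = 0 by have := LD 0 0; rewrite addr0; lra.
have LN v : L (- v) = - L v.
  by have := LD v (- v); rewrite subrr L0; lra.
(* If [v] has values in the image of [S], then [s] can be chosen with [emb s] equal to
   [at_point v y], so the norm term disappears; the inequality for [F] and for its opposite gives
   equality. *)
have L_emb (F : J -> K -> C) : (forall j, S (F j)) ->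
    L (fun j => emb (F j)) = complex.Re (\sum_j dotL2 mu (F j) (e j)).
  have main (H : J -> K -> C) : (forall j, S (H j)) ->
      L (fun j => emb (H j)) <= complex.Re (\sum_j dotL2 mu (H j) (e j)).
    move=> SH; have cH j := ccont_mulJ (fspan_ccont ce (SH j)) (ce j).
    pose g y := \sum_j H j y * (e j y)^*.
    have cg : ccont g by exact: ccont_sum.
    have -> : complex.Re (\sum_j dotL2 mu (H j) (e j)) =
        rint mu (fun y => complex.Re (g y)).
      by rewrite /dotL2 -(cint_sum mu cK _ cH).
    apply: le_trans (Lu _) _; apply: upper_le; split=> [|y];
      first exact: rcont_Re.
    have [Ss sE] := emb_sum (fun j => (e j y)^*) SH.
    exists (\sum_j (e j y)^* *: H j) => //.
    rewrite sE /at_point subrr rnorm0 addr0 fun_sumE /g.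
    by under eq_bigr do rewrite mulrC.
  move=> SF; apply: le_anti; rewrite main //=.
  have SNF j : S (-1 *: F j) by exact: SZ.
  have := main _ SNF; rewrite (_ : (fun j => emb (-1 *: F j)) = - (fun j => emb
    (F j))).
    rewrite LN (eq_bigr (fun j => - dotL2 mu (F j) (e j))).
      rewrite sumrN; case: (\sum_j _) => a b /=; lra.
    move=> j _; rewrite /dotL2 -!/(cint _ _).
    have cj := ccont_mulJ (fspan_ccont ce (SF j)) (ce j).
    rewrite -(cintN mu cK cj); congr cint; apply/funext => y.
    by rewrite -[(-1 *: F j) y]/(-1 * F j y) mulN1r mulNr.
  by apply/funext => j; rewrite embZ // scaleN1r.
(* Here [s = 0]: the dominating function is the norm of [rkernel e y x *: w], whose integral does
   not depend on [x]. *)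
have L_bound x (w : Y) : L (fun j => e j x *: w) <= M * rnorm w.
  pose h y : R := rnorm w * normc (rkernel e y x).
  have ck : rcont (fun y => normc (rkernel e y x)).
    by apply: rcont_normc; apply: kcont_l; exact: rkernel_cont.
  have -> : M * rnorm w = rint mu h.
    by rewrite (rintZ mu cK _ ck) (rint_rkernel hK inv ce oe S_inv x x0) mulrC.
  apply: le_trans (Lu _) _; apply: upper_le; split=> [|y]; first exact: rcontZ.
  exists (fun=> 0) => //=; rewrite emb0 subr0 add0r /at_point /h.
  under eq_bigr do rewrite scalerA.
  by rewrite -scaler_suml rnormZ mulrC.
(* The usual complexification L(v) - i L(i v) of a real-linear functional. *)
pose LC (v : J -> Y) : C := L v +i* (- L ('i%C *: v)).
have LCD v w : LC (v + w) = LC v + LC w.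
  by rewrite /LC scalerDr !LD opprD.
have ReIm (a : C) : a = (complex.Re a)%:C + (complex.Im a)%:C * 'i%C.
  by case: a => a b; apply/eqP;
    rewrite eq_complex /= !mulr0 !mul0r !mulr1 !subr0 !addr0 add0r !eqxx.
have La (a : C) v : L (a *: v) =
    complex.Re a * L v + complex.Im a * L ('i%C *: v).
  by rewrite {1}(ReIm a) scalerDl -scalerA LD !LZ.
have LCZ (a : C) v : LC (a *: v) = a * LC v.
  rewrite /LC scalerA (La a) (La ('i%C * a)).
  move: (L v) (L ('i%C *: v)) => p q; case: a => a b /=.
  apply/eqP; rewrite eq_complex /=.
  by apply/andP; split; apply/eqP; ring.
have LC_sum (I : Type) (r : seq I) (c : I -> C) (F : I -> J -> Y) :
    LC (\sum_(i <- r) c i *: F i) = \sum_(i <- r) c i * LC (F i).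
  elim: r => [|i r IHr]; last by rewrite !big_cons LCD LCZ IHr.
  by rewrite !big_nil /LC scaler0 L0 oppr0.
pose delta j (w : Y) : J -> Y := fun k => if k == j then w else 0.
pose nu j (w : Y) := LC (delta j w).
have nu_linear j (a : C) (w z : Y) : nu j (a *: w + z) = a * nu j w + nu j z.
  rewrite /nu -LCZ -LCD; congr LC; apply/funext => k.
  by rewrite /delta !fctE; case: eqP => //; rewrite scaler0 addr0.
(* Its coordinates are chosen so that its value at [x] is [LC] of the family [e j x *: w] ([PfE]),
   to which [L_bound] applies. *)
pose Pf (w : Y) : K -> C := \sum_j nu j w *: e j.
have SPf (w : Y) : S (Pf w) by exact: (emb_sum (fun j => nu j w) (fspan_mem
  e)).1.
have PfE (w : Y) x : Pf w x = LC (fun j => e j x *: w).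
  rewrite /Pf fun_sumE (_ : (fun j => _) = \sum_k e k x *: delta k w).
    by rewrite LC_sum; apply: eq_bigr => j _; rewrite mulrC.
  apply/funext => j; rewrite fct_sumE (bigD1 j) //= big1 => [|k kj].
    by rewrite addr0 -[RHS]/(e j x *: delta j w j) /delta eqxx.
  by rewrite -[LHS]/(e k x *: delta k w j) /delta eq_sym (negPf kj) scaler0.
pose P (w : Y) := emb (Pf w).
have P_bound (w : Y) : rnorm (P w) <= M * rnorm w.
  rewrite /P rnorm_emb //; apply: supnorm_le => x.
  (* Rotating [w] makes the value at [x] a real part, hence a value of [L]. *)
  have [a a1 az] := phase (Pf w x).
  have -> : normc (Pf w x) = L (fun j => e j x *: (a *: w)).
    move: az; rewrite PfE -LCZ (_ : a *: _ = fun j => e j x *: (a *: w)).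
      by move=> /(congr1 (@complex.Re R)).
    by apply/funext => j; rewrite -[LHS]/(a *: (e j x *: w)) !scalerA mulrC.
  by apply: le_trans (L_bound _ _) _; rewrite rnormZ a1 mul1r.
have P_linear : linear P.
  move=> a w z; rewrite /P -emb_linear //; congr emb.
  rewrite /Pf scaler_sumr -big_split; apply: eq_bigr => j _ /=.
  by rewrite nu_linear scalerDl scalerA.
have P_id f : S f -> P (emb f) = emb f.
  move=> Sf; rewrite /P; congr emb; rewrite -[RHS](oproj_id hK ce oe Sf).
  rewrite /Pf fun_sumE; apply/funext => x; apply: eq_bigr => j _; congr (_ * _).
  have Ldelta (s : K -> C) : S s -> L (delta j (emb s)) = complex.Re (dotL2 mu
    s (e j)).
    move=> Ss; rewrite (_ : delta _ _ = fun k => emb (if k == j then s else 0)).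
      rewrite L_emb => [|k]; last by case: eqP.
      rewrite (bigD1 j) //= eqxx big1 ?addr0 // => k /negPf ->.
      rewrite /dotL2 -/(cint _ _) -[RHS](cint_cst mu); congr cint.
      by apply/funext => y; rewrite mul0r.
    by apply/funext => k; rewrite /delta; case: eqP => //; rewrite emb0.
  rewrite /nu /LC Ldelta // (_ : 'i%C *: delta j (emb f) = delta j (emb ('i%C
    *: f))).
    rewrite Ldelta; last exact: SZ.
    have -> : dotL2 mu ('i%C *: f) (e j) = 'i%C * dotL2 mu f (e j).
      rewrite /dotL2 -!/(cint _ _).
      rewrite -(cintZ mu cK _ (ccont_mulJ (fspan_ccont ce Sf) (ce j))).
      by congr cint; apply/funext => y; rewrite mulrA.
    by case: (dotL2 _ _ _) => a b /=; rewrite mul0r mul1r sub0r opprK.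
  apply/funext => k; rewrite embZ // -[LHS]/('i%C *: delta j (emb f) k) /delta.
  by case: eqP => //; rewrite scaler0.
pose P' : {linear Y -> Y} := HB.pack_for {linear Y -> Y} P
  (GRing.isLinear.Build _ _ _ _ P P_linear).
have P'E (w : Y) : P' w = P w by [].
have PB (w z : Y) : P w - P z = P (w - z) by rewrite -!P'E linearB.
have M0 : 0 <= M by apply: rint_ge0 => y; exact: normc_ge0.
apply: (@le_trans _ _ (opnorm P')).
  apply: ereal_inf_lbound; exists P' => //; split=> [w|w|].
  - apply/cvgrPdist_lt => -[d i]; rewrite ltcE /= => /andP[/eqP -> d0].
    have d1 : 0 < d / (M + 1) by rewrite divr_gt0// ltr_wpDl.
    have d1C : 0 < (d / (M + 1))%:C :> C by rewrite ltcR.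
    apply: filterS (nbhsx_ballx w _ d1C) => z.
    rewrite -ball_normE /= PB !rnormE -[_ +i* 0]/(d%:C) !ltcR => wz.
    apply: le_lt_trans (P_bound _) _.
    rewrite ltr_pdivlMr ?ltr_wpDl// in wz; apply: le_lt_trans wz.
    by rewrite mulrDr mulr1 mulrC lerDl rnorm_ge0.
  - by rewrite !P'E P_id.
  - apply/seteqP; split=> [_ [w _ <-]|_ [f Sf <-]]; first by exists (Pf w).
    by exists (emb f) => //; rewrite P'E P_id.
apply: ub_ereal_sup => _ [w /= w1 <-]; rewrite lee_fin.
rewrite rnormE -[1]/(1%:C) lecR in w1.
apply: le_trans (P_bound w) _.
by rewrite -[leRHS]mulr1 ler_wpM2l.
Qed.

End UpperBound.

Theorem theorem1p16 (R : realType) (G : topologicalGroupType)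
    (K : ptopologicalType) (act : G -> K -> K)
    (mu : probability (borel K) R) (x0 : K)
    (Lambda : finType) (pi : Lambda -> unitary_rep R G)
    (u : forall i : Lambda, seq (rep_space (pi i)))
    (G_compact : compact_group G)
    (K_homogeneous : homogeneous_space act)
    (mu_regular : regular_measure mu)
    (mu_invariant : invariant_measure act mu)
    (pi_irreducible : forall i, irreducible (pi i))
    (pi_inequivalent : forall i j, i != j ->
       ~ unitarily_equivalent (pi i) (pi j))
    (u_basis : forall i, fixed_basis act x0 (u i)) :
  let S := sum_spaces (fun i => Epi act x0 (pi i)) in
  let kappa x :=
    \sum_(i : Lambda) (rep_dim (pi i))%:R * spherical_character act x0 (u i) x in
  [/\ accessible act mu S,
      forall (n : nat) (e : 'I_n -> (K -> R[i])), orthonormal_basisL2 mu S e ->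
        forall x, reproducing_kernel e x0 x = kappa x &
      projection_constant supnorm S =
        (\int[mu]_x (Normc.normc (kappa x))%:E)%E].
Proof.
move=> S kappa; have cG := G_compact.1; have cK := space_compact K_homogeneous.
have [J [e [ce oe SE kE]]] := S_basis cG K_homogeneous mu_invariant
  pi_irreducible pi_inequivalent u_basis.
have S_inv g f : S f -> S (translate act g f) by exact: S_translate.
have S_stable := @equivariant_stable R G K act x0 K_homogeneous Lambda pi.
(* From here [S] is the span of the orthonormal basis [e], the form required by the operator
   lemmas. *)
rewrite -/S in S_stable SE; rewrite SE in S_inv S_stable *.
have kapE x : rkernel e x0 x = kappa x by exact: kE.
have ck : ccont (rkernel e x0) by apply: kcont_r; exact: rkernel_cont.
split.
- split.
  + by move=> f Sf; apply/ccontP; exact: fspan_ccont Sf.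
  + exists #|J|, (fun i => e (enum_val i)); apply/seteqP.
    split=> [_ [c ->]|_ [c ->]] /=.
      exists (fun i => c (enum_val i)); rewrite fun_sumE; apply/funext => x.
      by rewrite (reindex _ (onW_bij _ (enum_val_bij J))).
    exists (fun j => c (enum_rank j)); rewrite fun_sumE; apply/funext => x.
    rewrite (reindex _ (onW_bij _ (enum_rank_bij J))) /=.
    by apply: eq_bigr => j _; rewrite enum_rankK.
  + exact: S_inv.
  + move=> Q pQ eQ f /ccontP cf.
    rewrite (equivariant_projection_unique cG K_homogeneous mu_invariant ce oe
      S_inv S_stable pQ eQ cf).
    exact: (oproj_orthogonal K_homogeneous ce oe cf).
- move=> n d od x; rewrite -kapE.
  exact: (onb_kernel_unique K_homogeneous ce oe od).
rewrite (_ : (fun x => _) = fun x => (normc (rkernel e x0 x))%:E); last first.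
  by apply/funext => x; rewrite kapE.
rewrite -(rintE mu cK (rcont_normc ck)); apply: le_anti; apply/andP; split.
  apply: ub_ereal_sup => _ [Y [j [jlin jiso ->]]].
  exact: (upper_projection K_homogeneous mu_invariant ce oe S_inv x0 jlin jiso).
exact: (projection_constant_lower K_homogeneous mu_invariant ce oe S_inv
  S_stable).
Qed.
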